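(* Let $N\in\mathbb{N}$, $a\ge0$, $b>0$, and put $\alpha:=a+b-1$, $\beta:=b-1$. For $\kappa>0$ let $\tilde X_\kappa$ be a random variable with values in $\tilde A:=\{t\in\mathbb{R}^N:\ \frac{\pi}{2}\ge t_1\ge\dots\ge t_N\ge 0\}$ whose distribution has Lebesgue density $$\tilde c_\kappa\prod_{1\le i<j\le N}\bigl(\cos(2t_j)-\cos(2t_i)\bigr)^{\kappa}\prod_{i=1}^N\sin(t_i)^{\kappa a}\sin(2t_i)^{\kappa b}$$ on $\tilde A$, with normalizing constant $\tilde c_\kappa>0$. Let $z_1\le\dots\le z_N$ be the ordered zeros of the Jacobi polynomial $P_N^{(\alpha,\beta)}$ and put $w:=\bigl(\tfrac12\arccos z_1,\dots,\tfrac12\arccos z_N\bigr)$. Then $\sqrt{\kappa}(\tilde X_\kappa-w)$ converges in distribution, as $\kappa\to\infty$, to the centered $N$-dimensional normal distribution $N(0,\tilde\Sigma)$, where the covariance matrix $\tilde\Sigma$ is invertible and its inverse $\tilde S=\tilde\Sigma^{-1}=(\tilde s_{i,j})_{i,j=1,\dots,N}$ is given by $$\tilde s_{j,j}=4\sum_{l\ne j}\frac{1-z_j^2}{(z_j-z_l)^2}+2(a+b)\frac{1+z_j}{1-z_j}+2b\frac{1-z_j}{1+z_j},\qquad \tilde s_{i,j}=\frac{-4\sqrt{(1-z_j^2)(1-z_i^2)}}{(z_i-z_j)^2}\ (i\ne j).$$ Furthermore, the eigenvalues of $\tilde S$ are simple and given by $\lambda_k=2k(2N+\alpha+\beta+1-k)>0$,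 $k=1,\dots,N$, and each $\lambda_k$ has an eigenvector of the form $$v_k=\bigl(q_{k-1}(z_1)\sqrt{1-z_1^2},\dots,q_{k-1}(z_N)\sqrt{1-z_N^2}\bigr)^T,$$ where $q_0,\dots,q_{N-1}$ are polynomials, $q_{k-1}$ of degree $k-1$, which are orthonormal with respect to the discrete measure $\mu_{N,\alpha,\beta}:=\sum_{i=1}^N(1-z_i^2)\delta_{z_i}$.
   Context: For $\alpha,\beta>-1$, $P_N^{(\alpha,\beta)}$ denotes the classical Jacobi polynomial of degree $N$, orthogonal on $]-1,1[$ with respect to the weight $(1-x)^\alpha(1+x)^\beta$; its $N$ zeros are simple and lie in $]-1,1[$. $\delta_x$ denotes the Dirac measure at $x$. *)

(* Defs.v *)
From HB Require Import structures.
From mathcomp Require Import all_boot all_order all_algebra.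
From mathcomp Require Import all_classical all_reals all_analysis.
Set Implicit Arguments. Unset Strict Implicit. Unset Printing Implicit Defensive.
Import Order.TTheory GRing.Theory Num.Theory.
Import numFieldNormedType.Exports.
Local Open Scope classical_set_scope.
Local Open Scope ring_scope.

Section Defs.
Variable R : realType.

Definition gbinom (x : R) (k : nat) : R :=
  (\prod_(i < k) (x - i%:R)) / (k`!)%:R.

Definition jacobi (n : nat) (al be : R) : {poly R} :=
  \sum_(s < n.+1)
     (gbinom (n%:R + al) (n - s) * gbinom (n%:R + be) s) *:
     ((2^-1 *: ('X - 1)) ^+ s * (2^-1 *: ('X + 1)) ^+ (n - s)).

Fixpoint iter_int_fun (n : nat) (f : (nat -> R) -> R) : R :=
  match n with
  | 0 => f (fun _ => 0)
  | m.+1 => Rintegral (@lebesgue_measure R) setT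
              (fun x => iter_int_fun m (fun v => f (fun i => if i == m then x else v i)))
  end.

Definition int_Rn (n : nat) (f : 'rV[R]_n -> R) : R :=
  iter_int_fun n (fun v => f (\row_(i < n) v (i : nat))).

Definition inAtilde (n : nat) (t : 'rV[R]_n) : bool :=
  [forall i : 'I_n, (0 <= t 0 i) && (t 0 i <= pi / 2)] &&
  [forall i : 'I_n, forall j : 'I_n, (i < j)%N ==> (t 0 j <= t 0 i)].

Definition dens_unnorm (n : nat) (a b kappa : R) (t : 'rV[R]_n) : R :=
  if inAtilde t then
    (\prod_(i < n) \prod_(j < n | (i < j)%N)
        ((cos (2 * t 0 j) - cos (2 * t 0 i)) `^ kappa)) *
    \prod_(i < n) ((sin (t 0 i)) `^ (kappa * a) * (sin (2 * t 0 i)) `^ (kappa * b))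
  else 0.

Definition dens (n : nat) (a b kappa : R) (t : 'rV[R]_n) : R :=
  dens_unnorm a b kappa t / int_Rn (@dens_unnorm n a b kappa).

Definition gauss_pdf (n : nat) (Sigma : 'M[R]_n) (x : 'rV[R]_n) : R :=
  (2 * pi) `^ (- (n%:R / 2)) / Num.sqrt (\det Sigma) *
  expR (- ((x *m invmx Sigma *m x^T) 0 0) / 2).

Definition expect_scaled (n : nat) (a b kappa : R) (w : 'rV[R]_n)
    (g : 'rV[R]_n -> R) : R :=
  int_Rn (fun t => g (Num.sqrt kappa *: (t - w)) * dens a b kappa t).

Definition cvg_dist_normal (n : nat) (a b : R) (w : 'rV[R]_n)
    (Sigma : 'M[R]_n) : Prop :=
  forall g : 'rV[R]_n -> R, continuous g ->
    (exists M : R, forall x, `|g x| <= M) ->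
    (fun kappa => expect_scaled a b kappa w g) @ +oo -->
       int_Rn (fun x => g x * gauss_pdf Sigma x).

Definition Stilde (n : nat) (a b : R) (z : 'I_n -> R) : 'M[R]_n :=
  \matrix_(i < n, j < n)
    if i == j then
      4 * (\sum_(l < n | l != j) (1 - z j ^+ 2) / (z j - z l) ^+ 2)
      + 2 * (a + b) * ((1 + z j) / (1 - z j))
      + 2 * b * ((1 - z j) / (1 + z j))
    else - 4 * Num.sqrt ((1 - z j ^+ 2) * (1 - z i ^+ 2)) / (z i - z j) ^+ 2.

Definition lambda (n : nat) (al be : R) (k : nat) : R :=
  2 * k%:R * (2 * n%:R + al + be + 1 - k%:R).

End Defs.

(* Main.v *)
Require Import Defs.
From HB Require Import structures.
From mathcomp Require Import all_boot all_order all_algebra.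
From mathcomp Require Import ring lra zify.
From mathcomp Require Import all_classical all_reals all_analysis.
From mathcomp Require Import measurable_realfun.
Import Order.TTheory GRing.Theory Num.Theory.
Import numFieldNormedType.Exports.
Set Implicit Arguments. Unset Strict Implicit. Unset Printing Implicit Defensive.
Local Open Scope classical_set_scope.
Local Open Scope ring_scope.

(** The Jacobi differential equation at the zeros gives Stieltjes' relations
    [2 sum_(l != j) 1 / (z j - z l) = (a + b) / (1 - z j) - b / (1 + z j)].
    With them, [S] acts on the vectors [p (z i) * sqrt (1 - z i ^ 2)] as an
    operator on polynomials [p] which is triangular in the degree with diagonal
    entries [lambda k]; this yields the spectrum, and symmetry of [S] the
    orthogonality.

    For the limit theorem, [cos 2y - cos 2x = 2 sin (x + y) sin (x - y)] turns
    the density into a product of powers of [sin (l t)] for linear forms [l].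
    Stieltjes' relations say that [w] is a critical point of the exponent and
    that its Hessian there is [- S]. As [(ln sin)'' = - 1 / sin^2 <= - 1], the
    rescaled density divided by its value at [w] is at most
    [exp (- 2 b |x|^2)] for every [kappa], so dominated convergence applies to
    the iterated integrals. Integrands are continuous and dominated by products
    of one-variable functions, a class stable under partial integration, so
    that no product measure is needed. *)

(** * Zeros of Jacobi polynomials *)

Section JacobiZeros.
Variable R : realType.
Implicit Types (al be x : R) (n s k : nat).

(** [Rintegral] is linear only on integrable functions, so each scaling, substitution or limit in
    [int_Rn] needs integrable slices at every level of nesting; hence continuity and a bound travel
    through all these inductions. The rate [2 b] comes from the factors [sin (2 t_i) ^ (kappa b)],
    whose forms [2 t_i] contribute [b (2 x_i)^2 / 2] each; for [a = 0] and [N = 1] no other factor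
    is left. The same terms give [4 b |x|^2 <= x S x^T], so positive definiteness of [S] is taken
    from the Hessian and not from the spectrum: the two halves of the theorem share only Stieltjes'
    relations and the symmetry of [S]. The normalizing constant is never evaluated. It is the
    numerator of the expectation for the test function 1, and the powers of [kappa] and the value of
    the density at [w] cancel in the quotient. *)

Definition jacobi_coef n al be s : R :=
  gbinom (n%:R + al) (n - s) * gbinom (n%:R + be) s.

Lemma gbinomS x k : gbinom x k.+1 * k.+1%:R = gbinom x k * (x - k%:R).
Proof.
rewrite /gbinom big_ord_recr /= factS natrM.
have h1 : k.+1%:R != 0 :> R by rewrite pnatr_eq0.
have h2 : (k`!)%:R != 0 :> R by rewrite pnatr_eq0 -lt0n fact_gt0.
by field; rewrite addrC natr1 h1 h2.
Qed.

Lemma gbinom_gt0 x k : k%:R - 1 < x -> 0 < gbinom x k.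
Proof.
move=> hx; rewrite /gbinom divr_gt0 ?ltr0n ?fact_gt0// prodr_gt0// => i _.
rewrite subr_gt0 (le_lt_trans _ hx)// lerBrDr natr1 ler_nat; exact: ltn_ord.
Qed.

Lemma jacobi_coef_gt0 n al be s :
  -1 < al -> -1 < be -> (s <= n)%N -> 0 < jacobi_coef n al be s.
Proof.
move=> hal hbe sn; apply: mulr_gt0; apply: gbinom_gt0.
  rewrite natrB//; have : 0 <= s%:R :> R by []. lra.
have : s%:R <= n%:R :> R by rewrite ler_nat.
lra.
Qed.

Lemma jacobi_coefS n al be s : (s < n)%N ->
  jacobi_coef n al be s.+1 * (s.+1%:R * (s.+1%:R + al)) =
  jacobi_coef n al be s * ((n%:R - s%:R) * (n%:R - s%:R + be)).
Proof.
move=> sn; rewrite /jacobi_coef -(subnSK sn).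
have := gbinomS (n%:R + al) (n - s.+1); have := gbinomS (n%:R + be) s.
rewrite natrB// -(natr1 (n - s.+1)) natrB// => e1 e2.
move: e1 e2; set A := gbinom _ _.+1; set B := gbinom _ _; set C := gbinom _ _.
set D := gbinom _ _; rewrite -!natr1 => e1 e2.
have -> : D * A * ((s%:R + 1) * (s%:R + 1 + al)) =
   (A * (s%:R + 1)) * (D * (s%:R + 1 + al)) by ring.
rewrite e1.
have -> : D * (s%:R + 1 + al) = C * (n%:R - s%:R).
  have -> : n%:R - s%:R = n%:R - (s%:R + 1) + 1 :> R by ring.
  by rewrite e2; ring.
by ring.
Qed.

Lemma jacobi_hornerE n al be x :
  (jacobi n al be).[x] = \sum_(s < n.+1) jacobi_coef n al be s *
    (((x - 1) / 2) ^+ s * ((x + 1) / 2) ^+ (n - s)).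
Proof.
rewrite /jacobi horner_sum; apply: eq_bigr => s _.
rewrite hornerZ hornerM !horner_exp !hornerZ -/(jacobi_coef n al be s).
by congr (_ * (_ ^+ _ * _ ^+ _)); rewrite mulrC !hornerE.
Qed.

(** All coefficients in the basis [((x - 1) / 2) ^ s * ((x + 1) / 2) ^ (n - s)] are positive, and
    the term [s = 0] does not vanish even at [x = 1]. *)
Lemma jacobi_gt0 n al be x : -1 < al -> -1 < be -> 1 <= x ->
  0 < (jacobi n al be).[x].
Proof.
move=> hal hbe hx; rewrite jacobi_hornerE big_ord_recl /= ltr_pwDl//.
  rewrite mulr_gt0 ?jacobi_coef_gt0// expr0 mul1r exprn_gt0//; lra.
apply: sumr_ge0 => s _; apply: mulr_ge0.
  by apply/ltW/jacobi_coef_gt0; rewrite // /bump add1n.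
by apply: mulr_ge0; apply: exprn_ge0; lra.
Qed.

(** The sign [(-1) ^ n] splits over the two powers and makes both bases nonnegative; here the term
    [s = n] survives at [x = -1]. *)
Lemma jacobi_neq0_left n al be x : -1 < al -> -1 < be -> x <= -1 ->
  (jacobi n al be).[x] != 0.
Proof.
move=> hal hbe hx; rewrite -(can_eq (signrMK n)) mulr0 gt_eqF//.
rewrite jacobi_hornerE mulr_sumr.
have E (s : 'I_n.+1) : (-1) ^+ n * (jacobi_coef n al be s *
    (((x - 1) / 2) ^+ s * ((x + 1) / 2) ^+ (n - s))) =
    jacobi_coef n al be s *
    (((1 - x) / 2) ^+ s * ((- 1 - x) / 2) ^+ (n - s)) :> R.
  have -> : (-1) ^+ n = (-1) ^+ s * (-1) ^+ (n - s) :> R.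
    by rewrite -exprD subnKC// -ltnS.
  have -> : (1 - x) / 2 = -1 * ((x - 1) / 2) by ring.
  have -> : (-1 - x) / 2 = -1 * ((x + 1) / 2) by ring.
  by rewrite !exprMn; ring.
under eq_bigr => s _ do rewrite E.
rewrite big_ord_recr /= ltr_wpDl//.
  apply: sumr_ge0 => s _; apply: mulr_ge0.
    by apply/ltW/jacobi_coef_gt0 => //; exact: ltnW.
  by apply: mulr_ge0; apply: exprn_ge0; lra.
rewrite mulr_gt0 ?jacobi_coef_gt0// subnn expr0 mulr1 exprn_gt0//; lra.
Qed.

Lemma root_jacobi_itv n al be x : -1 < al -> -1 < be ->
  root (jacobi n al be) x -> -1 < x < 1.
Proof.
move=> hal hbe /rootP h; rewrite !ltNge; apply/andP; split; apply/negP => hx.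
  by have := jacobi_neq0_left n hal hbe hx; rewrite h eqxx.
by have := jacobi_gt0 n hal hbe hx; rewrite h ltxx.
Qed.

Let u : {poly R} := 2^-1 *: ('X - 1).
Let v : {poly R} := 2^-1 *: ('X + 1).

Lemma deriv_uv s k : (u ^+ s * v ^+ k)^`() =
  (s%:R / 2) *: (u ^+ s.-1 * v ^+ k) + (k%:R / 2) *: (u ^+ s * v ^+ k.-1).
Proof.
have du : u^`() = (2^-1)%:P.
  by rewrite /u derivZ derivB derivX -polyC1 derivC subr0 -mul_polyC -polyCM mulr1.
have dv : v^`() = (2^-1)%:P.
  by rewrite /v derivZ derivD derivX -polyC1 derivC addr0 -mul_polyC -polyCM mulr1.
rewrite derivM !deriv_exp du dv.
rewrite -[_ *+ s]mulr_natl -[_ *+ k]mulr_natl -!mul_polyC !polyCM !polyC_natr.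
move: (u ^+ s) (u ^+ s.-1) (v ^+ k) (v ^+ k.-1) (2^-1)%:P => a b c d h.
ring.
Qed.

(* In [U = (x - 1) / 2] and [V = (x + 1) / 2] the equation is homogeneous, so that
   it reduces to the three-term relation [jacobi_coefS] between coefficients. *)
Lemma jacobi_ode_term al be x s k :
  let U := (x - 1) / 2 in let V := (x + 1) / 2 in let p := u ^+ s * v ^+ k in
  (x ^+ 2 - 1) * p^`()^`().[x] + (2 * ((al + 1) * V + (be + 1) * U)) * p^`().[x] =
  s%:R * (s%:R + al) * (U ^+ s.-1 * V ^+ k.+1)
  + (2 * s%:R * k%:R + (al + 1) * k%:R + (be + 1) * s%:R) * (U ^+ s * V ^+ k)
  + k%:R * (k%:R + be) * (U ^+ s.+1 * V ^+ k.-1).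
Proof.
move=> U V p; rewrite /p !deriv_uv derivD !derivZ !deriv_uv !hornerE /=.
have -> : x ^+ 2 - 1 = 4 * (U * V) by rewrite /U /V; field.
have -> : x - 1 = 2 * U by rewrite /U; field.
have -> : x + 1 = 2 * V by rewrite /V; field.
rewrite !mulKf ?pnatr_eq0//.
clearbody U V; clear p.
by case: s => [|[|s]]; case: k => [|[|k]] /=; rewrite ?exprS ?expr0; field.
Qed.

Lemma jacobi_ode n al be x :
  (1 - x ^+ 2) * (jacobi n al be)^`()^`().[x]
  + (be - al - (al + be + 2) * x) * (jacobi n al be)^`().[x]
  + n%:R * (n%:R + al + be + 1) * (jacobi n al be).[x] = 0.
Proof.
rewrite jacobi_hornerE.
have d1 : (jacobi n al be)^`() =
   \sum_(s < n.+1) jacobi_coef n al be s *: (u ^+ s * v ^+ (n - s))^`().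
  by rewrite raddf_sum; apply: eq_bigr => s _; exact: derivZ.
have d2 : (jacobi n al be)^`()^`() =
   \sum_(s < n.+1) jacobi_coef n al be s *: (u ^+ s * v ^+ (n - s))^`()^`().
  by rewrite d1 raddf_sum; apply: eq_bigr => s _; exact: derivZ.
rewrite d2 d1 !horner_sum !mulr_sumr -!big_split /=.
set U := (x - 1) / 2; set V := (x + 1) / 2; set c := jacobi_coef n al be.
transitivity (\sum_(s < n.+1) (
  c s * ((n%:R - s%:R) * s%:R + s%:R * s%:R + s%:R * al
    + (n%:R - s%:R) * (n%:R - s%:R + be)) * (U ^+ s * V ^+ (n - s))
  - c s * (s%:R * (s%:R + al)) * (U ^+ s.-1 * V ^+ (n - s).+1)
  - c s * ((n%:R - s%:R) * (n%:R - s%:R + be)) * (U ^+ s.+1 * V ^+ (n - s).-1)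
  + c s * (n%:R - s%:R) * s%:R * (U ^+ s * V ^+ (n - s)) * (-1))).
  apply: eq_bigr => s _; rewrite !hornerZ.
  have := jacobi_ode_term al be x s (n - s); rewrite -/U -/V => /= e.
  have -> : be - al - (al + be + 2) * x = - (2 * ((al + 1) * V + (be + 1) * U)).
    by rewrite /U /V; field.
  move: e; set P1 := _.[x]; set P2 := _.[x].
  rewrite natrB; last by rewrite -ltnS.
  set T := _ * (_ ^+ s * _); set T1 := _ * (_ ^+ s.-1 * _).
  move=> e.
  have -> : (1 - x ^+ 2) * (c s * P1) +
     - (2 * ((al + 1) * V + (be + 1) * U)) * (c s * P2) =
     - c s * ((x ^+ 2 - 1) * P1 + (2 * ((al + 1) * V + (be + 1) * U)) * P2) by ring.
  rewrite e /T /T1; ring.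
(* Both off-diagonal families are reindexed to [U ^ s * V ^ (n - s)] by [jacobi_coefS]; the boundary
   terms vanish through the factors [s] and [n - s]. *)
have shiftA : \sum_(s < n.+1) c s * (s%:R * (s%:R + al)) * (U ^+ s.-1 * V ^+ (n - s).+1)
  = \sum_(s < n.+1) c s * ((n%:R - s%:R) * (n%:R - s%:R + be)) * (U ^+ s * V ^+ (n - s)).
  rewrite big_ord_recl big_ord_recr /= !(mul0r, mulr0) add0r subrr !(mul0r, mulr0) addr0.
  apply: eq_bigr => s _; rewrite /bump /= add1n jacobi_coefS//.
  by rewrite subnSK.
have shiftC : \sum_(s < n.+1) c s * ((n%:R - s%:R) * (n%:R - s%:R + be)) * (U ^+ s.+1 * V ^+ (n - s).-1)
  = \sum_(s < n.+1) c s * (s%:R * (s%:R + al)) * (U ^+ s * V ^+ (n - s)).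
  rewrite big_ord_recr [RHS]big_ord_recl /= subrr !(mul0r, mulr0) add0r addr0.
  apply: eq_bigr => s _; rewrite /bump /= add1n jacobi_coefS//.
  by rewrite -subnS.
rewrite !big_split /= !sumrN shiftA shiftC -!sumrN -!big_split /=.
by rewrite big1// => s _; ring.
Qed.

Lemma size_jacobi_le n al be : (size (jacobi n al be) <= n.+1)%N.
Proof.
apply: (leq_trans (size_sum _ _ _)); apply/bigmax_leqP => s _.
apply: (leq_trans (size_scale_leq _ _)).
have sz c k : (size ((2^-1 *: ('X + c%:P : {poly R})) ^+ k) <= k.+1)%N.
  apply: (leq_trans (size_poly_exp_leq _ _)).
  rewrite ltnS -[leqRHS]mul1n leq_mul2r; apply/orP; right.
  by rewrite -subn1 leq_subLR (leq_trans (size_scale_leq _ _))// size_XaddC.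
apply: (leq_trans (size_polyMleq _ _)).
have h1 := sz (-1) s; have h2 := sz 1 (n - s)%N.
rewrite polyCN polyC1 in h1; rewrite polyC1 in h2.
rewrite -subn1 leq_subLR (leq_trans (leq_add h1 h2))//.
by rewrite addSn addnS add1n subnKC// -ltnS.
Qed.

Lemma deriv_prodXsubC (I : finType) (P : pred I) (y : I -> R) x :
  (forall i, P i -> x != y i) ->
  (\prod_(i | P i) ('X - (y i)%:P))^`().[x] =
  (\sum_(i | P i) (x - y i)^-1) * (\prod_(i | P i) ('X - (y i)%:P)).[x].
Proof.
(* The relation [p' = s p] at [x] turns products of [p] into sums of [s], so one induction treats
   the product and the sum together. *)
pose K (p : {poly R}) (s : R) := p^`().[x] = s * p.[x].
move=> h; apply: (@big_ind2 _ _ K); rewrite /K.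
- by rewrite -polyC1 derivC hornerC mul0r.
- by move=> p1 s1 p2 s2 e1 e2; rewrite derivM hornerD !hornerM e1 e2; ring.
- by move=> i Pi; rewrite derivXsubC !hornerE mulVf// subr_eq0; exact: h.
Qed.

Lemma jacobi_factor n al be (z : 'I_n -> R) : -1 < al -> -1 < be ->
  injective z -> (forall i, root (jacobi n al be) (z i)) ->
  exists2 c, c != 0 & jacobi n al be = c *: \prod_(i < n) ('X - (z i)%:P).
Proof.
move=> hal hbe zi zr; set p := jacobi n al be.
have p0 : p != 0.
  apply: contraTneq (jacobi_gt0 n hal hbe (lexx 1)) => p0.
  by rewrite -/p p0 horner0 ltxx.
pose rs := [seq z i | i <- enum 'I_n].
have szrs : size rs = n by rewrite size_map size_enum_ord.
have urs : uniq rs by rewrite map_inj_uniq ?enum_uniq.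
have ars : all (root p) rs by apply/allP => _ /mapP[i _ ->]; exact: zr.
(* The [n] distinct roots and the degree bound fix the degree; the leading coefficient is not
   computed. *)
have szp : size p = n.+1.
  apply/eqP; rewrite eqn_leq size_jacobi_le /= -[X in (X < _)%N]szrs.
  exact: max_poly_roots.
exists (lead_coef p); first by rewrite lead_coef_eq0.
rewrite [LHS](all_roots_prod_XsubC (rs := rs)) ?szrs ?uniq_rootsE//.
by rewrite big_map big_enum.
Qed.

(** Write the polynomial as [c (x - z j) q]. At [z j] its first two derivatives are [c q] and
    [2 c q'], the zeroth-order term of the differential equation drops out, and [q' / q] is the sum
    of reciprocals. *)
Lemma stieltjes n al be (z : 'I_n -> R) (j : 'I_n) : -1 < al -> -1 < be ->
  injective z -> (forall i, root (jacobi n al be) (z i)) ->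
  2 * \sum_(l < n | l != j) (z j - z l)^-1 =
  (al + 1) / (1 - z j) - (be + 1) / (1 + z j).
Proof.
move=> hal hbe zi zr.
have [c c0 pE] := jacobi_factor hal hbe zi zr.
have /andP[z1 z2] := root_jacobi_itv hal hbe (zr j).
pose q := \prod_(l < n | l != j) ('X - (z l)%:P).
have pq : jacobi n al be = c *: (('X - (z j)%:P) * q) by rewrite pE (bigD1 j).
have q0 : q.[z j] != 0.
  rewrite horner_prod; apply/prodf_neq0 => l lj.
  by rewrite !hornerE subr_eq0 (inj_eq zi) eq_sym.
have dq : q^`().[z j] = (\sum_(l < n | l != j) (z j - z l)^-1) * q.[z j].
  by apply: deriv_prodXsubC => l lj; rewrite (inj_eq zi) eq_sym.
have := jacobi_ode n al be (z j).
rewrite (rootP (zr j)) pq !(derivXsubC, derivZ, derivM, mul1r, derivD).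
rewrite !(hornerXsubC, hornerZ, hornerD, hornerM) dq subrr !(mul0r, mulr0, add0r, addr0).
rewrite -polyC1 derivC horner0 mul0r add0r.
set s := \sum_(_ < _ | _) _.
move=> e.
have e1 : (1 - z j ^+ 2) * (2 * s) = - (be - al - (al + be + 2) * z j).
  apply: (mulIf q0); apply: (mulIf c0); apply/eqP; rewrite -subr_eq0; apply/eqP.
  by rewrite -[RHS]e; ring.
have h : 1 - z j ^+ 2 != 0.
  by rewrite gt_eqF//; nra.
apply: (mulfI h); rewrite e1; field.
by rewrite !gt_eqF//; lra.
Qed.

End JacobiZeros.

(** * Spectrum of the matrix *)

Section Spectrum.
Variable R : realType.
Implicit Types (x y : R) (k d : nat).

(** As a polynomial in [x], the second-order Taylor quotient [(y^d - x^d - d x^(d-1) (y - x)) / (y -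
    x)^2] of the monomial of degree [d], expanded at [x]; its diagonal value is half the second
    derivative. *)
Fixpoint chord2 y d : {poly R} :=
  if d is d'.+1 then y *: chord2 y d' + d'%:R *: 'X^(d'.-1) else 0.

Lemma chord2E x y d :
  x ^+ d - y ^+ d = (x - y) * (d%:R * x ^+ d.-1) - (x - y) ^+ 2 * (chord2 y d).[x].
Proof.
elim: d => [|d IH]; first by rewrite /= !expr0 horner0; ring.
rewrite /= hornerD !hornerZ hornerXn.
have -> : x ^+ d.+1 - y ^+ d.+1 = y * (x ^+ d - y ^+ d) + (x - y) * x ^+ d.
  by rewrite !exprS; ring.
rewrite IH; case: d {IH} => [|d] /=; rewrite ?exprS; ring.
Qed.

Lemma chord2_diag x d : 2 * (chord2 x d).[x] = d%:R * d.-1%:R * x ^+ d.-2.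
Proof.
elim: d => [|d IH]; first by rewrite /= horner0; ring.
rewrite /= hornerD !hornerZ hornerXn mulrDr mulrCA IH.
by case: d {IH} => [|[|d]] /=; rewrite ?exprS; ring.
Qed.

Lemma size_chord2 y d : (size (chord2 y d) <= d.-1)%N.
Proof.
elim: d => [|d IH] /=; first by rewrite size_poly0.
apply: (leq_trans (size_polyD _ _)); rewrite geq_max; apply/andP; split.
  by apply: (leq_trans (size_scale_leq _ _)); apply: (leq_trans IH); exact: leq_pred.
case: d {IH} => [|d]; first by rewrite scale0r size_poly0.
by apply: (leq_trans (size_scale_leq _ _)); rewrite size_polyXn.
Qed.

Variables (N : nat) (a b : R) (z : 'I_N -> R).
Hypotheses (a0 : 0 <= a) (b0 : 0 < b) (zi : injective z).
Hypothesis z_itv : forall i, -1 < z i < 1.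
Hypothesis z_eq : forall j, 2 * \sum_(l < N | l != j) (z j - z l)^-1 =
  (a + b) / (1 - z j) - b / (1 + z j).

Let lam k := lambda N (a + b - 1) (b - 1) k.
Let S := Stilde a b z.
Let sq i := Num.sqrt (1 - z i ^+ 2).

Let z2_gt0 i : 0 < 1 - z i ^+ 2.
Proof. by have /andP[] := z_itv i => *; nra. Qed.

Let zB_neq0 i j : i != j -> z i - z j != 0.
Proof. by move=> ij; rewrite subr_eq0 (inj_eq zi). Qed.

(** [S] conjugated by the diagonal matrix of the [sqrt (1 - z i ^ 2)]. Diagonal and off-diagonal
    sums are merged into differences of [(1 - x ^ 2) p], ready for expansion at [z j]. *)
Definition Sop (p : {poly R}) j : R :=
  4 * (\sum_(l < N | l != j)
    ((1 - z j ^+ 2) * p.[z j] - (1 - z l ^+ 2) * p.[z l]) / (z j - z l) ^+ 2)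
  + (2 * (a + b) * ((1 + z j) / (1 - z j)) + 2 * b * ((1 - z j) / (1 + z j))) * p.[z j].

Lemma Stilde_mul p : S *m (\col_i (p.[z i] * sq i)) = \col_i (Sop p i * sq i).
Proof.
apply/colP => j; rewrite !mxE (bigD1 j)//= !mxE eqxx /Sop.
have -> : \sum_(i < N | i != j) S j i * (\col_i0 (p.[z i0] * sq i0)) i 0 =
  - (4 * \sum_(l < N | l != j) (1 - z l ^+ 2) * p.[z l] / (z j - z l) ^+ 2) * sq j.
  rewrite mulNr -mulrA -mulrN mulr_suml -sumrN mulr_sumr; apply: eq_bigr => i ij.
  rewrite !mxE eq_sym (negbTE ij) sqrtrM; last exact: ltW.
  rewrite -/(sq i) -/(sq j).
  have -> : 1 - z i ^+ 2 = sq i ^+ 2 by rewrite sqr_sqrtr// ltW.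
  by ring.
under [in RHS]eq_bigr do rewrite mulrBl.
rewrite sumrB.
have -> : \sum_(i < N | i != j) (1 - z j ^+ 2) * p.[z j] / (z j - z i) ^+ 2 =
    p.[z j] * \sum_(i < N | i != j) (1 - z j ^+ 2) / (z j - z i) ^+ 2.
  by rewrite mulr_sumr; apply: eq_bigr => i _; ring.
by ring.
Qed.

Lemma SopD p q j : Sop (p + q) j = Sop p j + Sop q j.
Proof.
rewrite /Sop hornerD.
have -> : \sum_(l < N | l != j)
    ((1 - z j ^+ 2) * (p.[z j] + q.[z j]) - (1 - z l ^+ 2) * (p + q).[z l]) / (z j - z l) ^+ 2 =
  \sum_(l < N | l != j) ((1 - z j ^+ 2) * p.[z j] - (1 - z l ^+ 2) * p.[z l]) / (z j - z l) ^+ 2 +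
  \sum_(l < N | l != j) ((1 - z j ^+ 2) * q.[z j] - (1 - z l ^+ 2) * q.[z l]) / (z j - z l) ^+ 2.
  by rewrite -big_split; apply: eq_bigr => l _; rewrite hornerD /=; ring.
by ring.
Qed.

Lemma SopZ c p j : Sop (c *: p) j = c * Sop p j.
Proof.
rewrite /Sop hornerZ.
have -> : \sum_(l < N | l != j)
    ((1 - z j ^+ 2) * (c * p.[z j]) - (1 - z l ^+ 2) * (c *: p).[z l]) / (z j - z l) ^+ 2 =
  c * \sum_(l < N | l != j) ((1 - z j ^+ 2) * p.[z j] - (1 - z l ^+ 2) * p.[z l]) / (z j - z l) ^+ 2.
  by rewrite mulr_sumr; apply: eq_bigr => l _; rewrite hornerZ /=; ring.
by ring.
Qed.

(** Let [f = (1 - x ^ 2) x ^ k]. By [chord2E] each summand is [f'(z j) / (z j - z l)] plus a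
    polynomial in [z j]. Stieltjes' relations turn the sum of the first parts into a rational
    function whose poles at 1 and -1 cancel those of the diagonal entries. The sum of the
    polynomials is completed by the index [l = j], so that the remainder [r] does not depend on [j];
    [chord2_diag] evaluates the added term. *)
Lemma Sop_Xn k : exists2 r : {poly R}, (size r <= k)%N &
  forall j, Sop 'X^k j = lam k.+1 * z j ^+ k + r.[z j].
Proof.
pose T l : {poly R} := z l *: chord2 (z l) k.+1 - chord2 (z l) k.
(* The first monomial is left over from the Stieltjes terms, the second from removing [T j] again.
   Where the truncated exponents fail to lie below [k], the coefficients are 0. *)
exists ((2 * k%:R * a) *: 'X^(k.-1) + (2 * k%:R * k.-1%:R) *: 'X^(k.-2) + 4 *: \sum_l T l).
  have szX c m d : (d < m)%N || (c == 0) -> (size (c *: 'X^d : {poly R}) <= m)%N.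
    case/orP => [dm|/eqP ->]; last by rewrite scale0r size_poly0.
    by rewrite (leq_trans (size_scale_leq _ _))// size_polyXn.
  rewrite (leq_trans (size_polyD _ _))// geq_max (leq_trans (size_polyD _ _))/=; last first.
    rewrite geq_max !szX//.
      by case: k {T} => [|[|k]] /=; rewrite ?mulr0 ?mul0r ?eqxx ?orbT// leqW.
    by case: k {T} => [|k] /=; rewrite ?mulr0 ?mul0r ?eqxx ?orbT ?ltnSn.
  rewrite (leq_trans (size_scale_leq _ _))// (leq_trans (size_sum _ _ _))//.
  apply/bigmax_leqP => l _; rewrite (leq_trans (size_polyD _ _))// geq_max size_polyN.
  rewrite (leq_trans (size_scale_leq _ _)) ?size_chord2//=.
  by rewrite (leq_trans (size_chord2 _ _))// leq_pred.
move=> j; have /andP[z1 z2] := z_itv j.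
have h1 : 1 - z j != 0 by rewrite gt_eqF//; lra.
have h2 : 1 + z j != 0 by rewrite gt_eqF//; lra.
set s := \sum_(l < N | l != j) (z j - z l)^-1.
pose r' := k%:R * z j ^+ k.-1 - k.+2%:R * z j ^+ k.+1.
have sumE : \sum_(l < N | l != j)
    ((1 - z j ^+ 2) * 'X^k.[z j] - (1 - z l ^+ 2) * 'X^k.[z l]) / (z j - z l) ^+ 2 =
    r' * s + (N%:R - 1) * (k.+1%:R * z j ^+ k) + \sum_(l < N | l != j) (T l).[z j].
  have -> : (N%:R - 1) * (k.+1%:R * z j ^+ k) = \sum_(l < N | l != j) (k.+1%:R * z j ^+ k).
    have -> : N%:R - 1 = (N.-1)%:R :> R.
      by rewrite -subn1 natrB// (leq_ltn_trans (leq0n j)).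
    by rewrite sumr_const cardC1 card_ord -[RHS]mulr_natl.
  rewrite mulr_sumr -!big_split; apply: eq_bigr => l lj /=.
  rewrite !hornerXn.
  have zl : z j - z l != 0 by rewrite zB_neq0// eq_sym.
  have e1 := chord2E (z j) (z l) k.
  have e2 := chord2E (z j) (z l) k.+2.
  have -> : (1 - z j ^+ 2) * z j ^+ k - (1 - z l ^+ 2) * z l ^+ k =
    (z j ^+ k - z l ^+ k) - (z j ^+ k.+2 - z l ^+ k.+2).
    by rewrite !exprS; ring.
  rewrite e1 e2 /T /= !hornerD hornerN !hornerZ hornerXn /r'.
  move: (chord2 (z l) k).[z j] => c1.
  by field.
rewrite /Sop sumE !hornerD !hornerZ !hornerXn horner_sum [in RHS](bigD1 j)//=.
have := chord2_diag (z j) k; have := chord2_diag (z j) k.+1.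
rewrite /T /= !hornerD hornerN !hornerZ hornerD !hornerZ hornerXn => e1 e2.
have es : s = ((a + b) / (1 - z j) - b / (1 + z j)) / 2.
  by rewrite -z_eq -/s; field.
rewrite es /lam /lambda /r'.
move: e1 e2; move: (\sum_(i < N | _) _) => X; move: (chord2 _ k).[z j] => c e1 e2.
have -> : c = (2 * c) / 2 by field.
rewrite e2; clear e1 e2 sumE; clear T r'.
by case: k => [|[|k]] /=; rewrite ?exprS ?expr0; field; rewrite h1 h2.
Qed.

(** [lam k - lam l = 2 (k - l) (2 N + a + 2 b - 1 - k - l)], and distinct [k, l <= N] satisfy
    [k + l <= 2 N - 1], so [b > 0] keeps the last factor positive. *)
Lemma lam_inj : {in [pred k : nat | (0 < k <= N)%N] &, injective lam}.
Proof.
move=> k l; rewrite !inE => /andP[k0 kN] /andP[l0 lN] e.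
apply/eqP; apply: contraT => kl.
have {}kl : (k%:R : R) - l%:R != 0 by rewrite subr_eq0 eqr_nat.
have e1 : 2 * (k%:R - l%:R) * (2 * N%:R + a + 2 * b - 1 - k%:R - l%:R) = 0.
  by rewrite -[RHS](subrr (lam k)) [X in _ = _ - X]e /lam /lambda; ring.
move/eqP: e1; rewrite !mulf_eq0 pnatr_eq0 (negbTE kl) /= => /eqP e1.
have : (k + l < N + N)%N.
  rewrite ltn_neqAle leq_add// andbT; apply: contra kl => /eqP h.
  rewrite subr_eq0 eqr_nat; apply/eqP; lia.
rewrite -(ler_nat R) -natr1 !natrD; move: a0 b0 e1; lra.
Qed.

Lemma lam_gt0 (k : 'I_N) : 0 < lam k.+1.
Proof.
rewrite /lam /lambda mulr_gt0 ?mulr_gt0//.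
have : (k.+1%:R : R) <= N%:R by rewrite ler_nat.
have : (1 : R) <= k.+1%:R by rewrite ler1n.
by move: a0 b0; lra.
Qed.

(** A triangular system with diagonal entries [lam k.+1 - t], solved from the leading coefficient
    downwards. *)
Lemma Sop_solve m (t : R) (r : {poly R}) : (size r <= m)%N ->
  (forall k, (k < m)%N -> lam k.+1 != t) ->
  exists2 s : {poly R}, (size s <= m)%N & forall j, Sop s j - t * s.[z j] = r.[z j].
Proof.
elim: m r => [|m IH] r sr ht.
  exists 0; first by rewrite size_poly0.
  move: sr; rewrite leqn0 size_poly_eq0 => /eqP -> j.
  by rewrite -(scale0r 0) SopZ hornerZ !horner0; ring.
have [rho srho Erho] := Sop_Xn m.
have d0 : lam m.+1 - t != 0 by rewrite subr_eq0; exact: ht.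
pose c := r`_m / (lam m.+1 - t).
have sr' : (size (r - r`_m *: 'X^m - c *: rho)%R <= m)%N.
  apply/leq_sizeP => i mi; rewrite !coefB !coefZ coefXn.
  rewrite (nth_default 0 (leq_trans srho mi)) mulr0 subr0.
  move: mi; rewrite leq_eqVlt => /orP[/eqP <-|mi]; first by rewrite eqxx mulr1 subrr.
  by rewrite (nth_default 0 (leq_trans sr mi)) gtn_eqF// mulr0 subr0.
have [s' ss' Es'] := IH _ sr' (fun k km => ht k (ltnW km)).
exists (c *: 'X^m + s').
  rewrite (leq_trans (size_polyD _ _))// geq_max (leqW ss') andbT.
  by rewrite (leq_trans (size_scale_leq _ _))// size_polyXn.
move=> j; rewrite SopD SopZ Erho hornerD hornerZ hornerXn.
have := Es' j; rewrite !hornerD !hornerN !hornerZ hornerXn => e.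
have -> : c * (lam m.+1 * z j ^+ m + rho.[z j]) + Sop s' j - t * (c * z j ^+ m + s'.[z j])
  = c * (lam m.+1 - t) * z j ^+ m + c * rho.[z j] + (Sop s' j - t * s'.[z j]) by ring.
by rewrite e /c divfK//; ring.
Qed.

(** The eigenpolynomial is ['X^k - s], where [s] of degree below [k] absorbs the lower-order rest of
    [Sop 'X^k]; it exists because the smaller indices have other eigenvalues. *)
Lemma Sop_eigen (k : 'I_N) : exists2 p : {poly R}, size p = k.+1 &
  forall j, Sop p j = lam k.+1 * p.[z j].
Proof.
have [rho srho Erho] := Sop_Xn k.
have [i ik|s ss Es] := Sop_solve (t := lam k.+1) srho.
  apply/eqP => /lam_inj; rewrite !inE /= !ltn_ord.
  move=> /(_ (ltn_trans ik (ltn_ord k)) isT) [ek].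
  by rewrite ek ltnn in ik.
exists ('X^k - s).
  by rewrite size_polyDl ?size_polyXn// size_polyN.
move=> j; rewrite -scaleN1r SopD SopZ Erho hornerD hornerZ hornerXn.
by have := Es j => e; rewrite (_ : Sop s j = rho.[z j] + lam k.+1 * s.[z j]) -?e; ring.
Qed.

Lemma Stilde_sym : S^T = S.
Proof.
apply/matrixP => i j; rewrite !mxE eq_sym; case: eqP => [->//|_].
by rewrite mulrC [(1 - z j ^+ 2) * _]mulrC -sqrrN opprB mulrC.
Qed.

(** A nonzero polynomial of degree below [N] cannot vanish at all [N] nodes, and the weights are
    positive. *)
Lemma weighted_norm_gt0 (p : {poly R}) : p != 0 -> (size p <= N)%N ->
  0 < \sum_(i < N) (1 - z i ^+ 2) * p.[z i] * p.[z i].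
Proof.
move=> p0 sp; have tge0 i : 0 <= (1 - z i ^+ 2) * p.[z i] * p.[z i].
  by rewrite -mulrA mulr_ge0 ?(ltW (z2_gt0 _))// -expr2 sqr_ge0.
rewrite lt_def sumr_ge0// andbT; apply/negP; rewrite psumr_eq0// => /allP h.
pose rs := [seq z i | i <- enum 'I_N].
have : (size rs < size p)%N.
  apply: max_poly_roots => //; last by rewrite map_inj_uniq ?enum_uniq.
  apply/allP => _ /mapP[i _ ->]; apply/rootP.
  have := h i (mem_index_enum i) => /=.
  by rewrite !mulf_eq0 (gt_eqF (z2_gt0 i)) /= orbb => /eqP.
by rewrite size_map size_enum_ord ltnNge sp.
Qed.

Lemma eigen_family : exists q : 'I_N -> {poly R},
  (forall k : 'I_N, size (q k) = k.+1) /\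
  (forall k l : 'I_N,
     \sum_(i < N) (1 - z i ^+ 2) * (q k).[z i] * (q l).[z i] = (k == l)%:R) /\
  (forall k : 'I_N,
     let v : 'cV[R]_N := \col_(i < N) ((q k).[z i] * Num.sqrt (1 - z i ^+ 2)) in
     v != 0 /\ S *m v = lam k.+1 *: v).
Proof.
have /choice [p hp] : forall k : 'I_N, exists p : {poly R}, size p = k.+1 /\
    forall j, Sop p j = lam k.+1 * p.[z j].
  by move=> k; have [p] := Sop_eigen k; exists p.
have p0 (k : 'I_N) : p k != 0 by rewrite -size_poly_eq0 (hp k).1.
pose nn (k : 'I_N) := \sum_(i < N) (1 - z i ^+ 2) * (p k).[z i] * (p k).[z i].
have nn0 (k : 'I_N) : 0 < nn k by apply: weighted_norm_gt0; rewrite // (hp k).1.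
pose c (k : 'I_N) := (Num.sqrt (nn k))^-1.
have c0 (k : 'I_N) : c k != 0 by rewrite invr_eq0 sqrtr_eq0 -ltNge.
pose q (k : 'I_N) := c k *: p k.
have sq2 i : sq i ^+ 2 = 1 - z i ^+ 2 by rewrite sqr_sqrtr// ltW.
pose v (k : 'I_N) : 'cV[R]_N := \col_(i < N) ((q k).[z i] * sq i).
have Sv (k : 'I_N) : S *m v k = lam k.+1 *: v k.
  rewrite Stilde_mul; apply/colP => j; rewrite !mxE SopZ (hp k).2 hornerZ; ring.
(* The two square roots multiply to the weight, so the discrete inner product is the Euclidean one
   of the eigenvectors. *)
have vv (k l : 'I_N) : (v k)^T *m v l = (\sum_(i < N) (1 - z i ^+ 2) * (q k).[z i] * (q l).[z i])%:M.
  rewrite [LHS]mx11_scalar; congr (_%:M); rewrite mxE; apply: eq_bigr => i _.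
  by rewrite !mxE -sq2; ring.
have orth (k l : 'I_N) : k != l -> \sum_(i < N) (1 - z i ^+ 2) * (q k).[z i] * (q l).[z i] = 0.
  move=> kl; have e : lam k.+1 *: ((v k)^T *m v l) = lam l.+1 *: ((v k)^T *m v l).
    rewrite scalemxAl scalemxAr -Sv mulmxA; congr (_ *m _).
    by rewrite -linearZ -Sv /= trmx_mul Stilde_sym.
  have ll : lam k.+1 - lam l.+1 != 0.
    rewrite subr_eq0; apply: contra_neq kl => /lam_inj; rewrite !inE /= !ltn_ord.
    by move/(_ isT isT) => [] /val_inj.
  move/eqP: e; rewrite -subr_eq0 -scalerBl scaler_eq0 (negbTE ll) /= vv.
  by move=> /eqP /matrixP /(_ 0 0); rewrite !mxE eqxx mulr1n.
have norm1 (k : 'I_N) : \sum_(i < N) (1 - z i ^+ 2) * (q k).[z i] * (q k).[z i] = 1.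
  transitivity (c k ^+ 2 * nn k).
    by rewrite mulr_sumr; apply: eq_bigr => i _; rewrite /q !hornerZ; ring.
  by rewrite /c exprVn sqr_sqrtr ?mulVf ?gt_eqF// ltW.
exists q; split; [|split].
- by move=> k; rewrite size_scale// (hp k).1.
- by move=> k l; case: eqP => [->//|/eqP kl]; rewrite ?norm1// orth.
- move=> k vk; split; last exact: Sv.
  apply/eqP => vk0; have := vv k k; rewrite norm1 /v -/vk vk0 mulmx0.
  by move/matrixP/(_ 0 0)/eqP; rewrite !mxE eqxx mulr1n eq_sym oner_eq0.
Qed.

Lemma char_poly_Stilde : char_poly S = \prod_(k < N) ('X - (lam k.+1)%:P).
Proof.
have [q [sq_q [oq eq_]]] := eigen_family.
pose rs := [seq lam k.+1 | k : 'I_N <- enum 'I_N].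
have szrs : size rs = N by rewrite size_map size_enum_ord.
rewrite [LHS](all_roots_prod_XsubC (rs := rs)).
- by rewrite (monicP (char_poly_monic _)) scale1r big_map big_enum.
- by rewrite size_char_poly szrs.
- apply/allP => _ /mapP[k _ ->]; rewrite -eigenvalue_root_char.
  have [v0 Sv] := eq_ k; set v := (X in X != 0) in v0 Sv.
  (* [eigenvalue] speaks of row vectors; symmetry of [S] allows the transposition. *)
  apply/eigenvalueP; exists v^T; last by rewrite trmx_eq0.
  by rewrite -linearZ /= -Sv trmx_mul Stilde_sym.
- rewrite uniq_rootsE map_inj_in_uniq ?enum_uniq// => k l _ _ /lam_inj.
  by rewrite !inE /= !ltn_ord => /(_ isT isT) [] /val_inj.
Qed.

End Spectrum.

(** * Dominated convergence for iterated integrals *)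

Section IteratedIntegral.
Variable R : realType.
Notation mu := (@lebesgue_measure R).
Implicit Types (f : (nat -> R) -> R) (x : R) (n m : nat).

Definition upd (v : nat -> R) m x : nat -> R := fun i => if i == m then x else v i.

Lemma iter_intS n f :
  iter_int_fun n.+1 f = Rintegral mu setT (fun x => iter_int_fun n (fun v => f (upd v n x))).
Proof. by []. Qed.

(** Continuity along coordinatewise convergent sequences: the form that dominated convergence
    consumes and produces. *)
Definition seq_cts f := forall (v_ : nat -> nat -> R) (v : nat -> R),
  (forall i, v_ k i @[k --> \oo] --> v i) -> f (v_ k) @[k --> \oo] --> f v.

Record dominant (h : nat -> R -> R) : Prop := Dominant {
  dom_ge0 : forall i x, 0 <= h i x ;
  dom_le1 : forall i x, h i x <= 1 ;
  dom_int : forall i, mu.-integrable setT (EFin \o h i) }.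

Definition prod_dominated (h : nat -> R -> R) n (C : R) f := forall v, `|f v| <= C * \prod_(i < n) h i (v i).


Lemma seq_continuous (g : R -> R) :
  (forall (x_ : nat -> R) x, x_ k @[k --> \oo] --> x -> g (x_ k) @[k --> \oo] --> g x) ->
  continuous g.
Proof.
move=> h x; apply/continuous_withinNx/cvgr_dnbhsP => u [_ ux].
exact: h.
Qed.

Lemma seq_cts_upd f n x : seq_cts f -> seq_cts (fun v => f (upd v n x)).
Proof.
move=> cf v_ v hv; apply: cf => i; rewrite /upd; case: ifP => // _.
exact: cvg_cst.
Qed.

Section Dominated.
Variable h : nat -> R -> R.
Hypothesis dh : dominant h.
Let H i := Rintegral mu setT (h i).

Lemma dominated_upd n C f x : 0 <= C -> prod_dominated h n.+1 C f ->
  prod_dominated h n (C * h n x) (fun v => f (upd v n x)).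
Proof.
move=> C0 df v; apply: (le_trans (df _)).
rewrite big_ord_recr /= [upd v n x n]/upd eqxx -mulrA ler_wpM2l//.
rewrite mulrC ler_wpM2l ?(dom_ge0 dh)//; rewrite le_eqVlt; apply/orP; left; apply/eqP; apply: eq_bigr => i _.
by rewrite /upd ltn_eqF.
Qed.

Definition iter_bound n := forall C f, 0 <= C -> seq_cts f -> prod_dominated h n C f ->
  `|iter_int_fun n f| <= C * \prod_(i < n) H i.

Definition iter_dct n := forall C (f_ : nat -> (nat -> R) -> R) f, 0 <= C ->
  (forall k, seq_cts (f_ k)) -> seq_cts f ->
  (forall k, prod_dominated h n C (f_ k)) -> prod_dominated h n C f ->
  (forall v, f_ k v @[k --> \oo] --> f v) ->
  iter_int_fun n (f_ k) @[k --> \oo] --> iter_int_fun n f.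

Section Slice.
Variables (n : nat) (C : R) (f : (nat -> R) -> R).
Hypotheses (ib : iter_bound n) (id : iter_dct n).
Hypotheses (C0 : 0 <= C) (cf : seq_cts f) (df : prod_dominated h n.+1 C f).

Let Phi x := iter_int_fun n (fun v => f (upd v n x)).

Lemma slice_bound x : `|Phi x| <= C * (\prod_(i < n) H i) * h n x.
Proof.
rewrite mulrAC; apply: ib; last exact: dominated_upd.
  by rewrite mulr_ge0 ?(dom_ge0 dh).
exact: seq_cts_upd.
Qed.

(* Dominated convergence in the first [n] variables: this is what makes the
   partial integrals measurable. *)
Lemma slice_continuous : continuous Phi.
Proof.
apply: seq_continuous => x_ x hx; apply: (id (C := C)) => //.
- by move=> k; exact: seq_cts_upd.
- exact: seq_cts_upd.
- move=> k v; apply: (le_trans (dominated_upd (x_ k) C0 df v)).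
  rewrite ler_wpM2r ?prodr_ge0 ?ler_piMr ?(dom_le1 dh)// => i _; exact: (dom_ge0 dh).
- move=> v; apply: (le_trans (dominated_upd x C0 df v)).
  rewrite ler_wpM2r ?prodr_ge0 ?ler_piMr ?(dom_le1 dh)// => i _; exact: (dom_ge0 dh).
- move=> v; apply: cf => i; rewrite /upd; case: ifP => // _; exact: cvg_cst.
Qed.

Lemma slice_integrable : mu.-integrable setT (EFin \o Phi).
Proof.
have i1 : mu.-integrable setT (EFin \o (fun x => C * (\prod_(i < n) H i) * h n x)).
  exact: (integrableZl measurableT _ (dom_int dh n)).
apply: (le_integrable _ _ _ i1) => //.
  by apply/measurable_EFinP; apply: continuous_measurable_fun; exact: slice_continuous.
move=> x _ /=; rewrite lee_fin (le_trans (slice_bound x))// ler_norm//.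
Qed.

End Slice.

(** The two claims are proved together: even the bound for [n.+1] needs integrable slices, whose
    measurability comes from dominated convergence for [n] and whose domination from the bound for
    [n]. *)
Lemma iter_int_dominated n : iter_bound n /\ iter_dct n.
Proof.
elim: n => [|n [ib id]].
  split=> [C f C0 cf df|C f_ f C0 cf_ cf df_ df ff] /=; last exact: ff.
  by have := df (fun=> 0); rewrite !big_ord0.
split=> [C f C0 cf df|C f_ f C0 cf_ cf df_ df ff]; rewrite iter_intS.
  apply: (le_trans (le_normr_Rintegral _ (slice_integrable ib id C0 cf df))) => //.
  rewrite big_ord_recr /= mulrA /H -RintegralZl//; last exact: (dom_int dh).
  apply: le_Rintegral => //.
  - by have /integrable_norm := slice_integrable ib id C0 cf df.
  - exact: (integrableZl measurableT _ (dom_int dh n)).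
  - by move=> x _; exact: slice_bound.
under eq_fun => k do rewrite iter_intS.
have fi := slice_integrable ib id C0 cf df.
apply: fine_cvg; rewrite fineK; last exact: integrable_fin_num.
have i1 : mu.-integrable setT (EFin \o (fun x => C * (\prod_(i < n) H i) * h n x)).
  exact: (integrableZl measurableT _ (dom_int dh n)).
have [] // := @dominated_convergence _ _ _ mu setT measurableT
  (fun k => EFin \o (fun x => iter_int_fun n (fun v => f_ k (upd v n x))))
  (EFin \o (fun x => iter_int_fun n (fun v => f (upd v n x)))) _ _ _ _ i1.
- move=> k; have /measurable_int := slice_integrable ib id C0 (cf_ k) (df_ k).
  by [].
- by have /measurable_int := fi.
- apply: aeW => x _ /=; apply: cvg_EFin; first exact: nearW.
  apply: (id (C * h n x)).
  + by rewrite mulr_ge0 ?(dom_ge0 dh).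
  + by move=> k; exact: seq_cts_upd.
  + exact: seq_cts_upd.
  + by move=> k; exact: dominated_upd.
  + exact: dominated_upd.
  + by move=> v; exact: ff.
- apply: aeW => x k _ /=; rewrite lee_fin; exact: slice_bound.
Qed.

End Dominated.

End IteratedIntegral.

(** * Change of variables and Gaussian integrals *)

Section IteratedIntegralRules.
Variable R : realType.
Notation mu := (@lebesgue_measure R).
Implicit Types (f : (nat -> R) -> R) (x : R) (n m : nat).

Lemma iter_int_eq n f g : f =1 g -> iter_int_fun n f = iter_int_fun n g.
Proof. by move=> fg; congr iter_int_fun; apply/funext. Qed.

Lemma iter_intZ (h : nat -> R -> R) n (C c : R) f : dominant h -> 0 <= C -> seq_cts f ->
  prod_dominated h n C f -> iter_int_fun n (fun v => c * f v) = c * iter_int_fun n f.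
Proof.
move=> dh; elim: n f C => [//|n IH] f C C0 cf df.
have [ib id] := iter_int_dominated dh n.
rewrite !iter_intS -RintegralZl//; last exact: (slice_integrable dh ib id C0 cf df).
apply: eq_Rintegral => x _; apply: (IH _ (C * h n x)).
- by rewrite mulr_ge0 ?(dom_ge0 dh).
- exact: seq_cts_upd.
- exact: dominated_upd.
Qed.

(** * Affine substitution *)

Section Affine.
Variables (w s : R).
Hypothesis s0 : 0 < s.
Let F (x : R^o) : R^o := w + s * x.

Let dF x : is_derive x 1 F s.
Proof.
by rewrite /F; apply: is_derive_eq; rewrite add0r mul1r /GRing.scale /= mulr1.
Qed.

Let F'E : F^`()%classic = cst s.
Proof. by apply/funext => x; rewrite derive1E; have [_ ->] := dF x. Qed.

Let cF : continuous F.
Proof. by move=> x; apply/differentiable_continuous/derivable1_diffP; have [] := dF x. Qed.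

Lemma ge0_integral_affine (G : R -> R) : continuous G -> (forall x, 0 <= G x) ->
  (\int[mu]_x (G x)%:E = \int[mu]_x (G (w + s * x) * s)%:E)%E.
Proof.
move=> cG G0; rewrite (@increasing_ge0_integration_by_substitutionT _ F)//.
- by apply: eq_integral => x _; rewrite F'E.
- by move=> x y xy; rewrite /F ltrD2l ltr_pM2l.
- by rewrite F'E => ?; exact: cvg_cst.
- by rewrite F'E; exact: is_cvg_cst.
- by rewrite F'E; exact: is_cvg_cst.
- apply/cvgrNyPle => A.
  apply: filterS (nbhs_ninfty_le (num_real ((A - w) / s))) => x.
  by rewrite ler_pdivlMr// lerBrDr addrC mulrC.
- apply/cvgryPge => A.
  apply: filterS (nbhs_pinfty_ge (num_real ((A - w) / s))) => x.
  by rewrite ler_pdivrMr// lerBlDr addrC mulrC.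
Qed.

Lemma continuous_max0 (f : R -> R) : continuous f -> continuous (fun x => Num.max (f x) 0).
Proof.
move=> cf x; under eq_fun do rewrite maxr_absE addr0 subr0.
apply: cvgM; last exact: cvg_cst.
by apply: cvgD; [exact: cf | apply: cvg_norm; exact: cf].
Qed.

(** Positive and negative parts are substituted separately; the positive factor [s] passes through
    the maximum with 0. *)
Lemma integral_affine (f : R -> R) : continuous f ->
  (\int[mu]_x (f x)%:E = \int[mu]_x (f (w + s * x) * s)%:E)%E.
Proof.
move=> cf; rewrite integralE [RHS]integralE; congr (_ - _)%E.
- transitivity (\int[mu]_x (Num.max (f x) 0)%:E)%E.
    by apply: eq_integral => x _; rewrite funeposE EFin_max.
  rewrite ge0_integral_affine; last 2 first.
  + exact: continuous_max0.
  + by move=> x; rewrite le_max lexx orbT.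
  apply: eq_integral => x _; rewrite funeposE -EFin_max maxr_pMl ?mul0r//.
  exact: ltW.
- transitivity (\int[mu]_x (Num.max (- f x) 0)%:E)%E.
    by apply: eq_integral => x _; rewrite funenegE EFin_max.
  rewrite ge0_integral_affine; last 2 first.
  + by apply: continuous_max0 => x; apply: cvgN; exact: cf.
  + by move=> x; rewrite le_max lexx orbT.
  apply: eq_integral => x _; rewrite funenegE -EFinN -EFin_max -mulNr.
  by rewrite maxr_pMl ?mul0r// ltW.
Qed.

Lemma integrable_affine (f : R -> R) : continuous f -> mu.-integrable setT (EFin \o f) ->
  mu.-integrable setT (EFin \o (fun x => f (w + s * x))).
Proof.
move=> cf /integrableP[_ fi]; apply/integrableP; split.
  apply/measurable_EFinP; apply: continuous_measurable_fun => x.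
  by apply: (cvg_comp F f); [exact: cF | exact: cf].
have e : (\int[mu]_x `|(EFin \o f) x| = \int[mu]_x (s%:E * `|f (w + s * x)|%:E))%E.
  rewrite -[LHS]/(\int[mu]_x (`|f x|)%:E)%E ge0_integral_affine//.
    by apply: eq_integral => x _; rewrite -EFinM mulrC.
  by move=> x; apply: cvg_norm; exact: cf.
move: fi; rewrite e ge0_integralZl//; last 2 first.
- apply/measurable_EFinP; apply: continuous_measurable_fun => x.
  by apply: cvg_norm; apply: (cvg_comp F f); [exact: cF | exact: cf].
- by rewrite lee_fin ltW.
apply: contraTT; rewrite -!leNgt !leye_eq => /eqP ->.
by rewrite mulry gtr0_sg// mul1e.
Qed.

Lemma Rintegral_affine (f : R -> R) : continuous f -> mu.-integrable setT (EFin \o f) ->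
  Rintegral mu setT f = s * Rintegral mu setT (fun x => f (w + s * x)).
Proof.
move=> cf fi; rewrite -RintegralZl//; last exact: integrable_affine.
rewrite /Rintegral integral_affine//.
by under [in RHS]eq_integral do rewrite mulrC.
Qed.
End Affine.

(** Needed in [iter_int_affine]: once all variables are integrated, the remaining coordinates are 0
    on one side and [w i] on the other. *)
Definition depends_on n f := forall v v' : nat -> R,
  (forall i, (i < n)%N -> v i = v' i) -> f v = f v'.

Lemma iter_int_affine (h : nat -> R -> R) n (C : R) f (w : nat -> R) (s : R) :
  0 < s -> dominant h -> 0 <= C ->
  seq_cts f -> prod_dominated h n C f -> depends_on n f ->
  iter_int_fun n f = s ^+ n * iter_int_fun n (fun v => f (fun i => w i + s * v i)).
Proof.
move=> s0 dh; elim: n f C => [|n IH] f C C0 cf df fdep.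
  by rewrite expr0 mul1r /=; exact: fdep.
have [ib id] := iter_int_dominated dh n.
have ci := slice_continuous dh id C0 cf df.
have ii := slice_integrable dh ib id C0 cf df.
rewrite !iter_intS (Rintegral_affine (w n) s0)// exprS -mulrA; congr (_ * _).
have e x : iter_int_fun n (fun v => f (fun i => w i + s * upd v n x i)) =
    (s ^+ n)^-1 * iter_int_fun n (fun v => f (upd v n (w n + s * x))).
  rewrite [in RHS](IH _ (C * h n (w n + s * x))).
  - rewrite mulKf ?expf_neq0 ?gt_eqF//; apply: iter_int_eq => v; congr f.
    by apply/funext => i; rewrite /upd; case: eqP => // ->.
  - by rewrite mulr_ge0 ?(dom_ge0 dh).
  - exact: seq_cts_upd.
  - exact: dominated_upd.
  - move=> v v' vv; apply: fdep => i; rewrite ltnS leq_eqVlt /upd.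
    by case: eqP => //= _; exact: vv.
under [in RHS]eq_Rintegral do rewrite e.
rewrite RintegralZl//; last exact: (integrable_affine (w n) s0 ci ii).
by rewrite mulVKf// expf_neq0// gt_eqF.
Qed.

Definition vcons x (v : nat -> R) : nat -> R := fun i => if i is i'.+1 then v i' else x.

(** No order of integration is exchanged: variable 0 already is the innermost one, and only the
    indices of the outer ones shift. *)
Lemma iter_int_recl n f : iter_int_fun n.+1 f =
  iter_int_fun n (fun v => Rintegral mu setT (fun x => f (vcons x v))).
Proof.
elim: n f => [|n IH] f.
  rewrite iter_intS /=; apply: eq_Rintegral => x _; congr f.
  by apply/funext; case.
rewrite iter_intS [RHS]iter_intS; apply: eq_Rintegral => y _; rewrite IH.
apply: iter_int_eq => v; apply: eq_Rintegral => x _; congr f.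
by apply/funext; case.
Qed.

(** * Gaussian integrals by completing the square *)

Lemma Rintegral_gauss (K d m : R) : 0 < d ->
  mu.-integrable setT (EFin \o (fun x => expR (- (d * (x + m) ^+ 2) / 2))) /\
  Rintegral mu setT (fun x => K * expR (- (d * (x + m) ^+ 2) / 2)) =
  K * Num.sqrt (2 * pi / d).
Proof.
move=> d0; pose s := (Num.sqrt d)^-1.
have s0 : s != 0 by rewrite invr_eq0 sqrtr_eq0 -ltNge.
have s2 : s ^+ 2 = d^-1 by rewrite exprVn sqr_sqrtr// ltW.
have pk : normal_peak s = (Num.sqrt (2 * pi / d))^-1.
  by rewrite /normal_peak s2; congr (Num.sqrt _)^-1; rewrite -mulr_natl; ring.
have pk0 : Num.sqrt (2 * pi / d) != 0.
  by rewrite gt_eqF// sqrtr_gt0 divr_gt0// mulr_gt0// pi_gt0.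
have e x : expR (- (d * (x + m) ^+ 2) / 2) = Num.sqrt (2 * pi / d) * normal_pdf (- m) s x.
  rewrite normal_pdfE//= pk mulVKf// /normal_fun s2 opprK; congr expR.
  by rewrite -mulr_natl; field; rewrite gt_eqF.
have i1 := integrable_normal_pdf (- m) s.
have i2 : mu.-integrable setT (EFin \o (fun x => expR (- (d * (x + m) ^+ 2) / 2))).
  under eq_fun do rewrite e.
  exact: (integrableZl measurableT _ i1).
split=> //; rewrite RintegralZl//; congr (_ * _).
under eq_Rintegral do rewrite e.
by rewrite RintegralZl// /Rintegral integral_normal_pdf mulr1.
Qed.


Definition qform n (A : 'M[R]_n) (x : 'rV[R]_n) : R := (x *m A *m x^T) 0 0.

Definition posdef n (A : 'M[R]_n) := forall x : 'rV[R]_n, x != 0 -> 0 < qform A x.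

Section Schur.
Variables (n : nat) (A : 'M[R]_(1 + n)).
Hypotheses (As : A^T = A) (Ap : posdef A).
Let d := ulsubmx A 0 0.
Let c : 'rV[R]_n := ursubmx A.
Definition schur : 'M[R]_n := drsubmx A - d^-1 *: (c^T *m c).

Lemma schur_pivot_gt0 : 0 < d.
Proof.
have x0 : row_mx (1%:M : 'M[R]_1) (0 : 'rV[R]_n) != 0.
  apply/eqP => /rowP /(_ (lshift n 0)); rewrite row_mxEl !mxE /= => /eqP.
  by rewrite oner_eq0.
have := Ap x0; rewrite /qform -{1}[A]submxK mul_row_block tr_row_mx mul_row_col.
rewrite trmx0 mulmx0 addr0 mul0mx addr0 mul1mx trmx1 mulmx1.
by [].
Qed.

Lemma qform_schur (x : R) (y : 'rV[R]_n) :
  qform A (row_mx x%:M y) = d * (x + (y *m c^T) 0 0 / d) ^+ 2 + qform schur y.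
Proof.
have d0 : d != 0 by rewrite gt_eqF// schur_pivot_gt0.
have dl : dlsubmx A = c^T.
  by rewrite /c -[X in ursubmx X]As trmx_ursub trmxK.
have ul : ulsubmx A = d%:M by rewrite [LHS]mx11_scalar.
have cy : c *m y^T = y *m c^T.
  have tr1 (M : 'M[R]_1) : M^T = M by rewrite [M]mx11_scalar tr_scalar_mx.
  by rewrite -[RHS]tr1 trmx_mul trmxK.
rewrite /qform -{1}[A]submxK mul_row_block tr_row_mx mul_row_col.
rewrite ul dl -/c /schur mulmxBr mulmxBl -scalemxAr -scalemxAl.
rewrite !mulmxDl tr_scalar_mx -!scalar_mxM mul_scalar_mx mul_mx_scalar.
rewrite (mulmxA y c^T c) -(mulmxA (y *m c^T) c) -scalemxAl cy.
move: (y *m c^T) (y *m drsubmx A *m y^T) => e f.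
have -> : e *m e = (e 0 0 ^+ 2)%:M.
  by rewrite [e]mx11_scalar -scalar_mxM !mxE eqxx mulr1n expr2.
rewrite !mxE /= !mulr1n; field.
by [].
Qed.

Lemma schur_posdef : posdef schur.
Proof.
move=> y y0; set e := (y *m c^T) 0 0.
(* At [- e / d] the completed square vanishes, and the form of [A] reduces to that of [schur]. *)
have x0 : row_mx (- e / d)%:M y != 0.
  by apply: contra_neq y0 => /(congr1 rsubmx); rewrite row_mxKr linear0.
have := Ap x0; rewrite qform_schur -/e mulNr addNr expr0n /= mulr0 add0r.
by [].
Qed.

Lemma schur_sym : schur^T = schur.
Proof.
by rewrite /schur linearB linearZ /= trmx_mul trmxK trmx_drsub As.
Qed.

Lemma det_schur : \det A = d * \det schur.
Proof.
have d0 : d != 0 by rewrite gt_eqF// schur_pivot_gt0.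
have dl : dlsubmx A = c^T.
  by rewrite /c -[X in ursubmx X]As trmx_ursub trmxK.
have ul : ulsubmx A = d%:M by rewrite [LHS]mx11_scalar.
have -> : A = block_mx 1%:M 0 (d^-1 *: c^T) 1%:M *m block_mx d%:M c 0 schur.
  rewrite mulmx_block !mul1mx !mul0mx !addr0 mul_mx_scalar.
  rewrite scalerA divff// scale1r -scalemxAl /schur addrCA subrr addr0.
  by rewrite -[LHS]submxK ul dl.
by rewrite det_mulmx det_lblock !det1 !mul1r det_ublock det_scalar expr1.
Qed.

End Schur.

(** Integrating the innermost variable over its completed square leaves [sqrt (2 pi / d)] and the
    Gaussian of the Schur complement, while the determinant loses the factor [d]. The constant [K]
    is general so that it can collect these factors. *)
Lemma iter_int_gauss n (A : 'M[R]_n) (K : R) : A^T = A -> posdef A ->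
  0 < \det A /\
  iter_int_fun n (fun v => K * expR (- qform A (\row_(i < n) v i) / 2)) =
  K * Num.sqrt ((2 * pi) ^+ n / \det A).
Proof.
elim: n A K => [|n IH] A K As Ap.
  split; first by rewrite det_mx00.
  by rewrite /= /qform !mxE big_ord0 det_mx00 oppr0 mul0r expR0 expr0 divr1 sqrtr1.
have [dS IHS] := IH _ (K * Num.sqrt (2 * pi / (ulsubmx (A : 'M[R]_(1 + n)) 0 0)))
  (schur_sym As) (schur_posdef As Ap).
have d0 := schur_pivot_gt0 Ap.
rewrite (det_schur As Ap); split; first exact: mulr_gt0.
rewrite iter_int_recl.
set d := ulsubmx _ 0 0 in d0 IHS *.
have e v : Rintegral mu setT
    (fun x => K * expR (- qform A (\row_(i < n.+1) vcons x v i) / 2)) =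
    K * Num.sqrt (2 * pi / d) * expR (- qform (schur A) (\row_(i < n) v i) / 2).
  under eq_Rintegral => x _.
    have -> : \row_(i < n.+1) vcons x v i = row_mx x%:M (\row_(i < n) v i) :> 'rV[R]_(1 + n).
      apply/rowP => i; rewrite !mxE; case: splitP => [j ->|k ->].
        by rewrite ord1 mxE eqxx.
      by rewrite mxE.
    rewrite qform_schur// -/d opprD mulrDl expRD [expR _ * _]mulrC mulrA.
  over.
  by rewrite (Rintegral_gauss _ _ d0).2 mulrAC.
rewrite (iter_int_eq n e) IHS -mulrA; congr (_ * _); rewrite -sqrtrM.
  by congr Num.sqrt; rewrite exprS; field; rewrite !gt_eqF.
by rewrite divr_ge0 ?mulr_ge0 ?pi_ge0// ltW.
Qed.

End IteratedIntegralRules.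

(** * Second order expansion of ln sin *)

Section LogSin.
Variable R : realType.
Implicit Types (p q x A : R).

(** That [x] lies between [p] and [q] is expressed by a distance and a sign, uniformly in the order
    of the two points. *)
Lemma mvt_between (f df : R -> R) l r p q :
  (forall x, l < x < r -> is_derive x 1 f (df x)) -> l < p < r -> l < q < r ->
  exists x, [/\ l < x < r, `|x - p| <= `|q - p|, 0 <= (x - p) * (q - p) &
    f q - f p = df x * (q - p)].
Proof.
move=> hd hp hq.
have cts u v : l < u < r -> l < v < r -> {within `[u, v], continuous f}.
  move=> hu hv; apply: derivable_within_continuous => x.
  rewrite in_itv /= => /andP[ux xv].
  have [] // := hd x; lra.
have [pq|qp] := leP p q.
  have [x|c] := @MVT_segment _ f df p q pq _ (cts _ _ hp hq).
    by rewrite in_itv /= => /andP[px xq]; apply: hd; lra.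
  rewrite in_itv /= => /andP[pc cq] ->; exists c; split => //.
  - lra.
  - by rewrite !ger0_norm ?subr_ge0// lerD2r.
  - by rewrite mulr_ge0// subr_ge0.
have [x|c] := @MVT_segment _ f df q p (ltW qp) _ (cts _ _ hq hp).
  by rewrite in_itv /= => /andP[px xq]; apply: hd; lra.
rewrite in_itv /= => /andP[qc cp] e; exists c; split => //.
- lra.
- rewrite !ler0_norm ?subr_le0//; [lra | exact: ltW].
- by rewrite mulr_le0// subr_le0// ltW.
- by apply: oppr_inj; rewrite opprB e; ring.
Qed.

Definition cot x : R := cos x / sin x.

Lemma is_derive_lnsin x : 0 < x < pi -> is_derive x 1 (fun t => ln (sin t)) (cot x).
Proof.
move=> hx; have s0 := sin_gt0_pi hx.
have dl : is_derive (sin x) 1 (@ln R) (sin x)^-1 by exact: is_derive1_ln.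
have := @is_derive1_comp _ (@ln R) sin x _ _ dl (is_derive_sin x).
by rewrite /cot mulrC.
Qed.

Lemma is_derive_cot x : 0 < x < pi -> is_derive x 1 cot (- (sin x ^+ 2)^-1).
Proof.
move=> hx; have s0 := sin_gt0_pi hx.
have sn : sin x != 0 by rewrite gt_eqF.
have d1 : is_derive x 1 (fun t => (sin t)^-1) (- (sin x) ^- 2 *: cos x).
  exact: is_deriveV.
rewrite /cot; apply: is_derive_eq.
rewrite /GRing.scale /=.
by rewrite -[X in _ = - X]mul1r -(cos2Dsin2 x); field.
Qed.

(** Two mean value steps. The parameter [A] is the curvature to compare with: [A = 1] gives the
    global bound [lnsin_le], [A = 1 / sin p ^ 2] the limit [lnsin_cvg]. *)
Lemma lnsin_taylor A p q : 0 < p < pi -> 0 < q < pi ->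
  exists e t, [/\ 0 < e < pi, `|e - p| <= `|q - p|, 0 <= t <= (q - p) ^+ 2 &
   ln (sin q) - ln (sin p) - cot p * (q - p) + A * (q - p) ^+ 2 / 2 =
   (A - (sin e ^+ 2)^-1) * t].
Proof.
move=> hp hq.
pose psi x := cot x - cot p + A * (x - p).
have d1 x : 0 < x < pi ->
  is_derive x 1 (fun t => ln (sin t) - cot p * t + A * (t - p) ^+ 2 / 2) (psi x).
  move=> hx; have := is_derive_lnsin hx => h.
  by apply: is_derive_eq; rewrite /psi /GRing.scale /=; field.
have d2 x : 0 < x < pi -> is_derive x 1 psi (A - (sin x ^+ 2)^-1).
  move=> hx; have := is_derive_cot hx => h.
  by rewrite /psi; apply: is_derive_eq; rewrite /GRing.scale /=; ring.
have [x [hx xp xq e1]] := mvt_between d1 hp hq.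
have [e [he ep _ e2]] := mvt_between d2 hp hx.
exists e, ((x - p) * (q - p)); split => //.
- exact: le_trans ep xp.
- rewrite xq /= -(ger0_norm xq) normrM -[leRHS]ger0_norm ?sqr_ge0// normrX expr2.
  by rewrite ler_wpM2r.
- have e3 : psi p = 0 by rewrite /psi !subrr mulr0 addr0.
  rewrite mulrA -e2 e3 subr0 -e1; ring.
Qed.

Lemma lnsin_le p q : 0 < p < pi -> 0 < q < pi ->
  ln (sin q) - ln (sin p) - cot p * (q - p) <= - (q - p) ^+ 2 / 2.
Proof.
move=> hp hq; have [e [t [he _ /andP[t0 _] h]]] := lnsin_taylor 1 hp hq.
have s0 := sin_gt0_pi he.
have : 1 <= (sin e ^+ 2)^-1.
  by rewrite invf_ge1 ?exprn_gt0// exprn_ile1 ?sin_le1// ltW.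
move=> h1; have : (1 - (sin e ^+ 2)^-1) * t <= 0 by rewrite mulr_le0_ge0// subr_le0.
by rewrite -h; lra.
Qed.

Lemma cvg_invsqrt0 (k : nat -> R) : (forall n, 0 < k n) ->
  k n @[n --> \oo] --> +oo -> (Num.sqrt (k n))^-1 @[n --> \oo] --> 0.
Proof.
move=> k0 ky; have sk0 n : 0 < Num.sqrt (k n) by rewrite sqrtr_gt0.
apply/cvgr0Pnorm_lt => e e0.
move/cvgryPgt : ky => /(_ (e^-1 ^+ 2)); apply: filterS => n hn.
rewrite ger0_norm ?invr_ge0 ?ltW// invf_plt ?posrE//.
by rewrite -(ger0_norm (ltW e0)) -normfV -sqrtr_sqr ltr_sqrt// normfV ger0_norm// ltW.
Qed.

(** The error is [k (A - 1 / sin e ^ 2) t] with [k t <= x ^ 2] and [e] squeezed towards [p]. *)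
Lemma lnsin_cvg p x (k : nat -> R) : 0 < p < pi -> (forall n, 0 < k n) ->
  k n @[n --> \oo] --> +oo ->
  k n * (ln (sin (p + x / Num.sqrt (k n))) - ln (sin p) - cot p * (x / Num.sqrt (k n)))
    @[n --> \oo] --> - (x ^+ 2 / sin p ^+ 2) / 2.
Proof.
move=> hp k0 ky; set A := (sin p ^+ 2)^-1.
have sk0 n : 0 < Num.sqrt (k n) by rewrite sqrtr_gt0.
have skV := cvg_invsqrt0 k0 ky.
have xq : x / Num.sqrt (k n) @[n --> \oo] --> 0.
  by rewrite -(mulr0 x); apply: cvgM => //; exact: cvg_cst.
have hq : \forall n \near \oo, 0 < p + x / Num.sqrt (k n) < pi.
  have pq : p + x / Num.sqrt (k n) @[n --> \oo] --> p.
    by rewrite -[X in _ --> X](addr0 p); apply: cvgD => //; exact: cvg_cst.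
  have /andP[p0 ppi] := hp.
  near=> n; apply/andP; split; near: n.
    exact: (cvgr_gt p).
  exact: (cvgr_lt p).
pose D n := ln (sin (p + x / Num.sqrt (k n))) - ln (sin p) - cot p * (x / Num.sqrt (k n)).
(* The pair [(0, 0)] is a dummy for the indices at which the point is still outside the interval. *)
have /choice[et het] : forall n, exists et : R * R, 0 < p + x / Num.sqrt (k n) < pi ->
   [/\ `|et.1 - p| <= `|x / Num.sqrt (k n)|, 0 <= et.2 <= (x / Num.sqrt (k n)) ^+ 2 &
   D n + A * (x / Num.sqrt (k n)) ^+ 2 / 2 = (A - (sin et.1 ^+ 2)^-1) * et.2].
  move=> n; have [hn|hn] := pselect (0 < p + x / Num.sqrt (k n) < pi); last by exists (0, 0).
  have [e [t [_ h1 h2 h3]]] := lnsin_taylor A hp hn.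
  exists (e, t) => _; move: h1 h2 h3; rewrite /D /=.
  have -> : p + x / Num.sqrt (k n) - p = x / Num.sqrt (k n) by ring.
  by [].
have ecvg : (et n).1 @[n --> \oo] --> p.
  apply/subr_cvg0/norm_cvg0P.
  apply: (@squeeze_cvgr _ _ _ _ (fun=> 0) (fun n => `|x / Num.sqrt (k n)|)).
  - near=> n; rewrite normr_ge0 /=; have [] // := het n _.
    by near: n; exact: hq.
  - exact: cvg_cst.
  - by apply/norm_cvg0P.
have Acvg : A - (sin (et n).1 ^+ 2)^-1 @[n --> \oo] --> 0.
  rewrite -[X in _ --> X](subrr A); apply: cvgB; first exact: cvg_cst.
  apply: cvgV; first by rewrite expf_neq0// gt_eqF// sin_gt0_pi.
  rewrite expr2; under eq_fun do rewrite expr2.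
  by apply: cvgM; (apply: cvg_comp; [exact: ecvg | exact: continuous_sin]).
have -> : - (x ^+ 2 / sin p ^+ 2) / 2 = - (A * x ^+ 2 / 2) by rewrite /A; ring.
apply/subr_cvg0/norm_cvg0P.
apply: (@squeeze_cvgr _ _ _ _ (fun=> 0)
  (fun n => `|A - (sin (et n).1 ^+ 2)^-1| * x ^+ 2)).
- near=> n; rewrite normr_ge0 /=.
  have [] := het n _; first by near: n; exact: hq.
  move=> _ /andP[t0 t1] h; rewrite -/(D n) opprK.
  have kx : k n * (x / Num.sqrt (k n)) ^+ 2 = x ^+ 2.
    by rewrite expr_div_n sqr_sqrtr ?ltW// mulrC divfK// gt_eqF.
  have -> : k n * D n + A * x ^+ 2 / 2 =
      k n * (D n + A * (x / Num.sqrt (k n)) ^+ 2 / 2) by rewrite -kx; ring.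
  rewrite h mulrCA normrM ler_wpM2l// ger0_norm ?mulr_ge0 ?(ltW (k0 n))//.
  by rewrite -kx ler_wpM2l// ltW.
- exact: cvg_cst.
- rewrite -(mul0r (x ^+ 2)); apply: cvgM; last exact: cvg_cst.
  exact/norm_cvg0P.
Unshelve. all: by end_near. Qed.
End LogSin.

(** * Limits of finite products, sums, powers and rows *)

Section CvgBig.
Variable R : realType.

Lemma cvg_bigprod (I : Type) (r : seq I) (P : pred I) (f : I -> nat -> R) (l : I -> R) :
  (forall i, P i -> f i n @[n --> \oo] --> l i) ->
  \prod_(i <- r | P i) f i n @[n --> \oo] --> \prod_(i <- r | P i) l i.
Proof.
move=> h; elim: r => [|i r IH].
  by under eq_fun do rewrite big_nil; rewrite big_nil; exact: cvg_cst.
under eq_fun do rewrite big_cons; rewrite big_cons.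
by case: ifP => // Pi; apply: cvgM => //; exact: h.
Qed.

Lemma cvg_bigsum (I : Type) (r : seq I) (P : pred I) (f : I -> nat -> R) (l : I -> R) :
  (forall i, P i -> f i n @[n --> \oo] --> l i) ->
  \sum_(i <- r | P i) f i n @[n --> \oo] --> \sum_(i <- r | P i) l i.
Proof.
move=> h; elim: r => [|i r IH].
  by under eq_fun do rewrite big_nil; rewrite big_nil; exact: cvg_cst.
under eq_fun do rewrite big_cons; rewrite big_cons.
by case: ifP => // Pi; apply: cvgD => //; exact: h.
Qed.

Lemma cvg_powR_ge0 (y : nat -> R) (l r : R) : 0 <= r -> (forall n, 0 <= y n) ->
  y n @[n --> \oo] --> l -> y n `^ r @[n --> \oo] --> l `^ r.
Proof.
rewrite le_eqVlt => /orP[/eqP <- _ _|r0 y0 yl].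
  by under eq_fun do rewrite powRr0; rewrite powRr0; exact: cvg_cst.
have l0 : 0 <= l.
  by rewrite -(cvg_lim _ yl)//; apply: limr_ge; [exact: cvgP yl | exact: nearW].
move: l0; rewrite le_eqVlt => /orP[/eqP l0|l0].
  rewrite -l0 powR0 ?gt_eqF//; apply/cvgr0Pnorm_lt => e e0.
  have e1 : 0 < e `^ r^-1 by rewrite powR_gt0.
  move: yl; rewrite -l0 => /cvgr0Pnorm_lt /(_ _ e1); apply: filterS => n.
  rewrite !ger0_norm ?powR_ge0// => h.
  have -> : e = (e `^ r^-1) `^ r by rewrite -powRrM mulVf ?gt_eqF// powRr1// ltW.
  by apply: gt0_ltr_powR => //; rewrite nnegrE ?powR_ge0.
have c : {for l, continuous (fun a : R => a `^ r)}.
  apply/differentiable_continuous/derivable1_diffP.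
  by apply: derivable_powR; rewrite in_itv /= andbT.
exact: (@cvg_comp _ _ _ y (fun a : R => a `^ r) _ _ _ yl c).
Qed.

Lemma cvg_row n (v_ : nat -> nat -> R) (v : nat -> R) :
  (forall i, v_ k i @[k --> \oo] --> v i) ->
  (\row_(i < n) v_ k i : 'rV[R]_n) @[k --> \oo] --> (\row_(i < n) v i : 'rV[R]_n).
Proof.
move=> h; apply/cvg_ballP => e e0.
have : \forall k \near \oo, forall i : 'I_n, ball (v i) e (v_ k i).
  apply: filter_forall => i; move: (h i) => /cvg_ballP; exact.
by apply: filterS => k hk; split => // i j; rewrite !mxE; exact: hk.
Qed.
End CvgBig.

(** * Critical point and Hessian of the exponent *)

Section Potential.
Variables (R : realType) (N : nat) (a b : R).
Implicit Types (t x : 'rV[R]_N) (phi : R -> R -> R).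

(* The sum of [phi] over the linear forms [l] in the factorisation of the
   density into factors [sin (l t)], weighted by their exponents and evaluated
   at the values [l t] and [l x]. *)
Definition Phi phi t x : R :=
  \sum_(i < N) \sum_(j < N | (i < j)%N)
    (phi (t 0 i + t 0 j) (x 0 i + x 0 j) + phi (t 0 i - t 0 j) (x 0 i - x 0 j))
  + \sum_(i < N) (a * phi (t 0 i) (x 0 i) + b * phi (2 * t 0 i) (2 * x 0 i)).

Definition intA t := (forall i, 0 < t 0 i < pi / 2) /\
  (forall i j : 'I_N, (i < j)%N -> t 0 j < t 0 i).

Lemma intA_sub t (i j : 'I_N) : intA t -> (i < j)%N -> 0 < t 0 i - t 0 j < pi.
Proof.
move=> [h1 h2] ij; have := h2 _ _ ij; have /andP[] := h1 i; have /andP[] := h1 j.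
lra.
Qed.

Lemma intA_add t (i j : 'I_N) : intA t -> 0 < t 0 i + t 0 j < pi.
Proof. move=> [h1 _]; have /andP[] := h1 i; have /andP[] := h1 j; lra. Qed.

Lemma intA_one t i : intA t -> 0 < t 0 i < pi.
Proof. move=> [h1 _]; have /andP[] := h1 i; lra. Qed.

Lemma intA_two t i : intA t -> 0 < 2 * t 0 i < pi.
Proof. move=> [h1 _]; have /andP[] := h1 i; lra. Qed.

Lemma eq_Phi phi phi' t t' x x' : intA t ->
  (forall p q, 0 < p < pi -> phi p q = phi' p q) -> t = t' -> x = x' ->
  Phi phi t x = Phi phi' t' x'.
Proof.
move=> ht e <- <-; rewrite /Phi; congr (_ + _).
  apply: eq_bigr => i _; apply: eq_bigr => j ij.
  by rewrite !e ?intA_sub ?intA_add.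
by apply: eq_bigr => i _; rewrite !e ?intA_one ?intA_two.
Qed.

Lemma PhiD phi psi t x :
  Phi (fun p q => phi p q + psi p q) t x = Phi phi t x + Phi psi t x.
Proof.
rewrite /Phi addrACA -!big_split /=; apply: eq_bigr => i _.
congr (_ + _); last by ring.
by rewrite -big_split; apply: eq_bigr => j _ /=; ring.
Qed.

Lemma PhiZ c phi t x : Phi (fun p q => c * phi p q) t x = c * Phi phi t x.
Proof.
rewrite /Phi mulrDr !mulr_sumr; congr (_ + _); apply: eq_bigr => i _.
  by rewrite mulr_sumr; apply: eq_bigr => j _; ring.
by ring.
Qed.

Lemma PhiE_shift (f : R -> R) t x : Phi (fun p _ => f p) (t + x) 0 =
  Phi (fun p q => f (p + q)) t x.
Proof.
rewrite /Phi; congr (_ + _); apply: eq_bigr => i _.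
  by apply: eq_bigr => j _; rewrite !mxE; congr (f _ + f _); ring.
by rewrite !mxE; congr (_ * f _ + _ * f _); ring.
Qed.

Lemma le_Phi phi psi t x : 0 <= a -> 0 <= b ->
  (forall i j : 'I_N, (i < j)%N -> phi (t 0 i + t 0 j) (x 0 i + x 0 j) <= psi (t 0 i + t 0 j) (x 0 i + x 0 j)) ->
  (forall i j : 'I_N, (i < j)%N -> phi (t 0 i - t 0 j) (x 0 i - x 0 j) <= psi (t 0 i - t 0 j) (x 0 i - x 0 j)) ->
  (forall i, phi (t 0 i) (x 0 i) <= psi (t 0 i) (x 0 i)) ->
  (forall i, phi (2 * t 0 i) (2 * x 0 i) <= psi (2 * t 0 i) (2 * x 0 i)) ->
  Phi phi t x <= Phi psi t x.
Proof.
move=> a0 b0 h1 h2 h3 h4; apply: lerD.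
  by apply: ler_sum => i _; apply: ler_sum => j ij; apply: lerD; [exact: h1 | exact: h2].
by apply: ler_sum => i _; apply: lerD; rewrite ler_wpM2l.
Qed.

Lemma cvg_Phi (phi_ : nat -> R -> R -> R) phi t x : intA t ->
  (forall p q, 0 < p < pi -> phi_ k p q @[k --> \oo] --> phi p q) ->
  Phi (phi_ k) t x @[k --> \oo] --> Phi phi t x.
Proof.
move=> ht h; apply: cvgD; apply: cvg_bigsum => i _.
  apply: cvg_bigsum => j ij; apply: cvgD; apply: h.
    exact: intA_add.
  exact: intA_sub.
apply: cvgD; (apply: cvgM; first exact: cvg_cst); apply: h.
  exact: intA_one.
exact: intA_two.
Qed.

Lemma sum_pairs (U : 'I_N -> 'I_N -> R) :
  \sum_(i < N) \sum_(j < N | (i < j)%N) (U i j + U j i) =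
  \sum_(i < N) \sum_(j < N | j != i) U i j.
Proof.
under eq_bigr do rewrite big_split /=.
rewrite big_split /=.
rewrite [X in _ + X](exchange_big_dep xpredT)//= -big_split /=.
apply: eq_bigr => i _; rewrite [RHS](bigID (fun j : 'I_N => (i < j)%N)) /=.
congr (_ + _); apply: eq_bigl => j; rewrite -val_eqE /=; lia.
Qed.

Section AtZeros.
Variable z : 'I_N -> R.
Hypotheses (a0 : 0 <= a) (b0 : 0 < b).
Hypothesis zmono : {homo z : i j / (i < j)%N >-> i < j}.
Hypothesis z_itv : forall i, -1 < z i < 1.
Hypothesis z_eq : forall j, 2 * \sum_(l < N | l != j) (z j - z l)^-1 =
  (a + b) / (1 - z j) - b / (1 + z j).

Let w : 'rV[R]_N := \row_(i < N) (acos (z i) / 2).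
Let s i := sin (2 * w 0 i).

Let zi : injective z.
Proof.
move=> i j e; apply/val_inj; case: (ltngtP i j) => // /zmono; rewrite e ltxx//.
Qed.

Let z2_gt0 i : 0 < 1 - z i ^+ 2.
Proof. by have /andP[] := z_itv i => *; nra. Qed.

Let zB_neq0 i j : i != j -> z i - z j != 0.
Proof. by move=> ij; rewrite subr_eq0 (inj_eq zi). Qed.

Let w2 i : 2 * w 0 i = acos (z i).
Proof. by rewrite mxE mulrC divfK// pnatr_eq0. Qed.

Let cos2w i : cos (2 * w 0 i) = z i.
Proof. by rewrite w2 acosK// in_itv /=; have /andP[? ?] := z_itv i; rewrite !ltW. Qed.

Let s_sqrt i : s i = Num.sqrt (1 - z i ^+ 2).
Proof. by rewrite /s w2 sin_acos//; have /andP[? ?] := z_itv i; rewrite !ltW. Qed.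

Let s2 i : s i ^+ 2 = 1 - z i ^+ 2.
Proof. by rewrite s_sqrt sqr_sqrtr// ltW. Qed.

Let s_gt0 i : 0 < s i. Proof. by rewrite s_sqrt sqrtr_gt0. Qed.

Lemma intA_w : intA w.
Proof.
split=> [i|i j ij].
  have /andP[z1 z2] := z_itv i.
  have := @acos_gt0 R (z i); have := @acos_ltpi R (z i); rewrite -!w2.
  rewrite z1 z2 !ltW//= => /(_ isT) h1 /(_ isT) h2; apply/andP; lra.
suff : 2 * w 0 j < 2 * w 0 i by lra.
have inpi k : 2 * w 0 k \in `[0, pi].
  rewrite w2 in_itv /=; have /andP[? ?] := z_itv k.
  by rewrite acos_ge0 ?acos_lepi// !ltW.
by rewrite -(ltr_cos (inpi j) (inpi i)) !cos2w zmono.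
Qed.

Lemma sin_sub_add (x y : R) : sin (x + y) * sin (x - y) = (cos (2 * y) - cos (2 * x)) / 2.
Proof.
rewrite sinD sinB !(mulrDl 1 1) !mul1r !cosD -!expr2.
transitivity (sin x ^+ 2 * cos y ^+ 2 - cos x ^+ 2 * sin y ^+ 2); first by ring.
by rewrite !cos2sin2; field.
Qed.

Lemma cot_pair i j : i != j ->
  cot (w 0 i + w 0 j) + cot (w 0 i - w 0 j) = 2 * s i * - (z i - z j)^-1.
Proof.
move=> ij; have e := sin_sub_add (w 0 i) (w 0 j); rewrite !cos2w in e.
have zij := zB_neq0 ij.
have pm0 : sin (w 0 i + w 0 j) * sin (w 0 i - w 0 j) != 0.
  by rewrite e mulf_neq0// ?invr_eq0 ?pnatr_eq0// -opprB oppr_eq0.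
have es : s i = sin (w 0 i + w 0 j) * cos (w 0 i - w 0 j) +
    cos (w 0 i + w 0 j) * sin (w 0 i - w 0 j).
  by rewrite -sinD /s; congr sin; ring.
have : cot (w 0 i + w 0 j) + cot (w 0 i - w 0 j) =
    s i / (sin (w 0 i + w 0 j) * sin (w 0 i - w 0 j)).
  move: pm0; rewrite mulf_eq0 negb_or => /andP[p0 m0].
  by rewrite es /cot; field; rewrite p0 m0.
move=> ->; rewrite e; field.
by rewrite zij -opprB oppr_eq0 zij.
Qed.

Let z1B_neq0 i : 1 - z i != 0.
Proof. by rewrite gt_eqF//; have /andP[] := z_itv i; lra. Qed.

Let z1D_neq0 i : 1 + z i != 0.
Proof. by rewrite gt_eqF//; have /andP[] := z_itv i; lra. Qed.

Lemma sin_sqr_half (x : R) : sin x ^+ 2 = (1 - cos (2 * x)) / 2.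
Proof. by rewrite (mulrDl 1 1) !mul1r cosD -!expr2 cos2sin2; field. Qed.

Lemma cot_w i : cot (w 0 i) = s i / (1 - z i).
Proof.
have e := sin_sqr_half (w 0 i); rewrite cos2w in e.
have s0 : sin (w 0 i) != 0 by rewrite gt_eqF// sin_gt0_pi// intA_one//; exact: intA_w.
have -> : 1 - z i = 2 * sin (w 0 i) ^+ 2 by rewrite e; field.
by rewrite /s (mulrDl 1 1) mul1r sinD /cot; field.
Qed.

Lemma cot_2w i : cot (2 * w 0 i) = z i * s i / ((1 - z i) * (1 + z i)).
Proof.
have -> : (1 - z i) * (1 + z i) = s i ^+ 2 by rewrite s2; ring.
by rewrite /cot cos2w -/(s i); field; rewrite gt_eqF.
Qed.

(** The coefficient of [x i] is [s i] times [- 2 sum 1 / (z i - z j) + a / (1 - z i) + 2 b z i / (1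
    - z i ^ 2)]; in partial fractions the last two terms are the right side of Stieltjes'
    relation. *)
Lemma Phi_grad x : Phi (fun p q => cot p * q) w x = 0.
Proof.
pose U (i j : 'I_N) := x 0 i * (cot (w 0 i + w 0 j) + cot (w 0 i - w 0 j)).
have cotN y : cot (- y) = - cot y :> R by rewrite /cot cosN sinN invrN mulrN.
transitivity (\sum_(i < N) \sum_(j < N | (i < j)%N) (U i j + U j i) +
  \sum_(i < N) (a * (cot (w 0 i) * x 0 i) + b * (cot (2 * w 0 i) * (2 * x 0 i)))).
  congr (_ + _); apply: eq_bigr => i _; apply: eq_bigr => j _.
  rewrite /U -[w 0 j - w 0 i]opprB cotN [w 0 j + w 0 i]addrC; ring.
rewrite sum_pairs -big_split big1//= => i _.
have -> : \sum_(j < N | j != i) U i j =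
    - (x 0 i * s i) * (2 * \sum_(j < N | j != i) (z i - z j)^-1).
  rewrite mulr_sumr mulr_sumr; apply: eq_bigr => j ji.
  by rewrite /U cot_pair 1?eq_sym//; ring.
rewrite z_eq cot_w cot_2w; field.
by rewrite z1B_neq0 z1D_neq0.
Qed.

Lemma sin2_add i j : sin (w 0 i + w 0 j) ^+ 2 = (1 - z i * z j + s i * s j) / 2.
Proof.
by rewrite sin_sqr_half mulrDr cosD !cos2w -/(s i) -/(s j); ring.
Qed.

Lemma sin2_sub i j : sin (w 0 i - w 0 j) ^+ 2 = (1 - z i * z j - s i * s j) / 2.
Proof.
by rewrite sin_sqr_half mulrBr cosB !cos2w -/(s i) -/(s j); ring.
Qed.

(** [A + B] and [A - B] are twice the squared sines of the sum and the difference, with product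
    [(z i - z j) ^ 2]. On the diagonal, [1 - z i * z j = (1 - z i ^ 2) + z i (z i - z j)]; the
    second part is summed by Stieltjes' relation. *)
Lemma Phi_hess x : Phi (fun p q => q ^+ 2 / sin p ^+ 2) w x = qform (Stilde a b z) x.
Proof.
pose A i j := 1 - z i * z j; pose B i j := s i * s j.
pose U (i j : 'I_N) := 4 * (x 0 i ^+ 2 * A i j - x 0 i * x 0 j * B i j) / (z i - z j) ^+ 2.
have ABe i j : (A i j + B i j) * (A i j - B i j) = (z i - z j) ^+ 2.
  have -> : (A i j + B i j) * (A i j - B i j) = A i j ^+ 2 - s i ^+ 2 * s j ^+ 2.
    by rewrite /B; ring.
  by rewrite !s2 /A; ring.
transitivity (\sum_(i < N) \sum_(j < N | (i < j)%N) (U i j + U j i) +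
  \sum_(i < N) (a * (x 0 i ^+ 2 / sin (w 0 i) ^+ 2) +
     b * ((2 * x 0 i) ^+ 2 / s i ^+ 2))).
  congr (_ + _); apply: eq_bigr => i _; apply: eq_bigr => j ij.
  have zij : z i - z j != 0 by rewrite zB_neq0// neq_ltn ij.
  rewrite sin2_add sin2_sub /U.
  have -> : A j i = A i j by rewrite /A mulrC.
  have -> : B j i = B i j by rewrite /B mulrC.
  have -> : (z j - z i) ^+ 2 = (z i - z j) ^+ 2 by rewrite -sqrrN opprB.
  have : (A i j + B i j) * (A i j - B i j) != 0 by rewrite ABe expf_neq0.
  rewrite -ABe -/(A i j) -/(B i j) mulf_eq0 negb_or => /andP[h1 h2].
  by field; rewrite h1 h2.
rewrite sum_pairs -big_split /= /qform mxE.
apply: eq_bigr => i _; rewrite [x^T i 0]mxE [(x *m _) 0 i]mxE mulr_suml [in RHS](bigD1 i)//=.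
have -> : \sum_(j < N | j != i) U i j =
    x 0 i ^+ 2 * (4 * (\sum_(l < N | l != i) (1 - z i ^+ 2) / (z i - z l) ^+ 2) +
      2 * z i * (2 * \sum_(l < N | l != i) (z i - z l)^-1)) +
    \sum_(k < N | k != i) x 0 k * Stilde a b z k i * x 0 i.
  rewrite !mulr_sumr -big_split mulr_sumr -big_split; apply: eq_bigr => j ji /=.
  have zij : z i - z j != 0 by rewrite zB_neq0// eq_sym.
  rewrite !mxE (negbTE ji) sqrtrM ?(ltW (z2_gt0 _))// -!s_sqrt /U /A /B.
  have -> : (z j - z i) ^+ 2 = (z i - z j) ^+ 2 by rewrite -sqrrN opprB.
  by field.
rewrite z_eq [Stilde a b z i i]mxE eqxx sin_sqr_half cos2w s2.
have -> : 1 - z i ^+ 2 = (1 - z i) * (1 + z i) by ring.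
by field; rewrite z1B_neq0 z1D_neq0.
Qed.

(** All terms of the Hessian are nonnegative; those of the forms [2 * w i] alone suffice, as
    [sin ^ 2 <= 1]. *)
Lemma qform_ge x : 4 * b * \sum_(i < N) x 0 i ^+ 2 <= qform (Stilde a b z) x.
Proof.
rewrite -Phi_hess /Phi mulr_sumr ler_wpDl//.
  apply: sumr_ge0 => i _; apply: sumr_ge0 => j _.
  by rewrite addr_ge0// divr_ge0// sqr_ge0.
apply: ler_sum => i _; rewrite ler_wpDl//.
  by rewrite mulr_ge0// divr_ge0// sqr_ge0.
have s1 : 0 < sin (2 * w 0 i) ^+ 2 <= 1.
  by rewrite exprn_gt0 ?s_gt0//= exprn_ile1 ?sin_le1// ltW// s_gt0.
have -> : 4 * b * x 0 i ^+ 2 = b * (2 * x 0 i) ^+ 2 by ring.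
rewrite ler_wpM2l ?(ltW b0)// ler_peMr ?sqr_ge0// invf_ge1//; by case/andP: s1.
Qed.

End AtZeros.
End Potential.

(** * The density *)

Section Density.
Variables (R : realType) (N : nat) (a b : R).
Hypotheses (a0 : 0 <= a) (b0 : 0 < b).
Implicit Types (t x : 'rV[R]_N) (k : R).

(* Clamping the argument makes the density, extended by 0, a product of globally
   continuous factors. *)
Definition csin (y : R) : R := sin (Num.max 0 (Num.min y pi)).

Lemma csinE y : 0 <= y <= pi -> csin y = sin y.
Proof.
move=> /andP[y0 ypi]; rewrite /csin; congr sin.
by rewrite (min_idPl ypi) (max_idPr y0).
Qed.

Lemma csin_eq0 y : y <= 0 \/ pi <= y -> csin y = 0.
Proof.
have p0 := pi_gt0 R.
case=> hy; rewrite /csin.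
  by rewrite (min_idPl (le_trans hy (ltW p0))) (max_idPl hy) sin0.
by rewrite (min_idPr hy) (max_idPr (ltW p0)) sinpi.
Qed.

Lemma csin_ge0 y : 0 <= csin y.
Proof.
by apply: sin_ge0_pi; rewrite le_max lexx /= ge_max pi_ge0 ge_min lexx orbT.
Qed.

Lemma cvg_csin (y : nat -> R) (l : R) : y n @[n --> \oo] --> l ->
  csin (y n) @[n --> \oo] --> csin l.
Proof.
move=> yl.
have c : continuous (fun y : R => Num.max 0 (Num.min y pi)).
  move=> u; under eq_fun do rewrite maxr_absE minr_absE.
  have c1 : (u0 + pi - `|u0 - pi|) / 2 @[u0 --> u] --> (u + pi - `|u - pi|) / 2.
    apply: cvgM; last exact: cvg_cst.
    apply: cvgB; first by apply: cvgD; [exact: cvg_id | exact: cvg_cst].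
    by apply: cvg_norm; apply: cvgB; [exact: cvg_id | exact: cvg_cst].
  apply: cvgM; last exact: cvg_cst.
  apply: cvgD; first by apply: cvgD; [exact: cvg_cst | exact: c1].
  by apply: cvg_norm; apply: cvgB; [exact: cvg_cst | exact: c1].
apply: (@cvg_comp _ _ _ (fun n => Num.max 0 (Num.min (y n) pi)) sin).
  exact: (cvg_comp _ _ yl (c l)).
exact: continuous_sin.
Qed.

Definition cdens k t : R :=
  (\prod_(i < N) \prod_(j < N | (i < j)%N)
     ((2 * (csin (t 0 i + t 0 j) * csin (t 0 i - t 0 j))) `^ k)) *
  \prod_(i < N) ((csin (t 0 i)) `^ (k * a) * (csin (2 * t 0 i)) `^ (k * b)).

Lemma dens_unnormE k t : 0 < k -> dens_unnorm a b k t = cdens k t.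
Proof.
move=> k0; rewrite /dens_unnorm /inAtilde.
case: (boolP [forall i, _]) => [/forallP h1|]; last first.
  rewrite negb_forall => /existsP[i hi]; apply/esym.
  (* The factor with exponent [k * b] is the one to use: [k * a] may be 0, and 0 to the power 0 is
     1. *)
  rewrite /cdens [X in _ * X](bigD1 i)//= [csin (2 * _)]csin_eq0; last first.
    by move: hi; rewrite negb_and -!ltNge => /orP[]; [left|right]; lra.
  by rewrite powR0 ?mulr0 ?mul0r ?mulr0// mulf_neq0 ?gt_eqF.
case: (boolP [forall i, forall j, _]) => [/forallP h2|]; last first.
  rewrite negb_forall => /existsP[i]; rewrite negb_forall => /existsP[j].
  rewrite negb_imply -ltNge => /andP[ij hij] /=; apply/esym.
  rewrite /cdens (bigD1 i)//= (bigD1 j)//= [csin (t 0 i - t 0 j)]csin_eq0; last by left; lra.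
  by rewrite !mulr0 powR0 ?gt_eqF// !mul0r.
rewrite /= /cdens; congr (_ * _); apply: eq_bigr => i _.
  apply: eq_bigr => j ij; rewrite !csinE.
  - by rewrite sin_sub_add; congr (_ `^ _); field.
  - have /forallP/(_ j) := h2 i; rewrite ij /=.
    by have /andP[] := h1 i; have /andP[] := h1 j; lra.
  - by have /andP[] := h1 i; have /andP[] := h1 j; lra.
by rewrite !csinE//; have /andP[] := h1 i; lra.
Qed.

Lemma cvg_cdens k (t_ : nat -> 'rV[R]_N) t : 0 < k ->
  (forall i, t_ n 0 i @[n --> \oo] --> t 0 i) -> cdens k (t_ n) @[n --> \oo] --> cdens k t.
Proof.
move=> k0 ht; apply: cvgM; apply: cvg_bigprod => i _.
  apply: cvg_bigprod => j _; apply: cvg_powR_ge0; first exact: ltW.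
    by move=> n; rewrite !mulr_ge0 ?csin_ge0.
  apply: cvgM; first exact: cvg_cst.
  by apply: cvgM; apply: cvg_csin; [apply: cvgD | apply: cvgB]; exact: ht.
apply: cvgM; apply: cvg_powR_ge0; rewrite ?mulr_ge0 ?(ltW k0) ?(ltW b0)//;
  try by move=> n; exact: csin_ge0.
  by apply: cvg_csin; exact: ht.
by apply: cvg_csin; apply: cvgM; [exact: cvg_cst | exact: ht].
Qed.

Lemma cdens_ge0 k t : 0 <= cdens k t.
Proof.
apply: mulr_ge0; apply: prodr_ge0 => i _; last by rewrite mulr_ge0 ?powR_ge0.
by apply: prodr_ge0 => j _; rewrite powR_ge0.
Qed.

Lemma cdens_eq0 k t : 0 < k -> ~ intA t -> cdens k t = 0.
Proof.
move=> k0 nt.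
case: (boolP [forall i, 0 < t 0 i < pi / 2]) => [/forallP h1|]; last first.
  rewrite negb_forall => /existsP[i hi].
  rewrite /cdens [X in _ * X](bigD1 i)//= [csin (2 * _)]csin_eq0; last first.
    by move: hi; rewrite negb_and -!leNgt => /orP[]; [left|right]; lra.
  by rewrite powR0 ?mulr0 ?mul0r ?mulr0// mulf_neq0 ?gt_eqF.
case: (boolP [forall i : 'I_N, forall j : 'I_N, (i < j)%N ==> (t 0 j < t 0 i)]) => [/forallP h2|].
  exfalso; apply: nt; split=> // i j ij.
  by have /forallP/(_ j)/implyP := h2 i; exact.
rewrite negb_forall => /existsP[i]; rewrite negb_forall => /existsP[j].
rewrite negb_imply -leNgt => /andP[ij hij] /=.
rewrite /cdens (bigD1 i)//= (bigD1 j)//= [csin (t 0 i - t 0 j)]csin_eq0; last by left; lra.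
by rewrite !mulr0 powR0 ?gt_eqF// !mul0r.
Qed.

(** The logarithm of the factors 2 in [cos 2y - cos 2x = 2 sin (x + y) sin (x - y)]; independent of
    the point, it cancels in ratios. *)
Definition lnc2 : R := \sum_(i < N) \sum_(j < N | (i < j)%N) ln 2.

Lemma cdens_exp k t : 0 < k -> intA t ->
  cdens k t = expR (k * (lnc2 + Phi a b (fun p _ => ln (sin p)) t 0)).
Proof.
move=> k0 ht; rewrite /Phi /lnc2 addrA -big_split mulrDr expRD; congr (_ * _).
  rewrite mulr_sumr expR_sum; apply: eq_bigr => i _.
  rewrite -big_split mulr_sumr expR_sum; apply: eq_bigr => j ij /=.
  have p1 := intA_add i j ht; have p2 := intA_sub ht ij.
  have s1 := sin_gt0_pi p1; have s2 := sin_gt0_pi p2.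
  rewrite !csinE; try by move: p1 p2; lra.
  rewrite /powR ifF; last by apply/negbTE; rewrite !mulf_neq0 ?gt_eqF.
  by rewrite !lnM ?posrE ?mulr_gt0.
rewrite mulr_sumr expR_sum; apply: eq_bigr => i _.
have p1 := intA_one i ht; have p2 := intA_two i ht.
have s1 := sin_gt0_pi p1; have s2 := sin_gt0_pi p2.
rewrite !csinE; try by move: p1 p2; lra.
by rewrite /powR !ifF ?gt_eqF// -expRD; congr expR; ring.
Qed.

(** * The density around its maximum *)

Section AtMax.
Variable w : 'rV[R]_N.
Hypothesis wA : intA w.
Hypothesis w_crit : forall x, Phi a b (fun p q => cot p * q) w x = 0.

(** The first-order term can be subtracted under [Phi] for free because its total vanishes; then
    each linear form can be estimated by itself. *)
Lemma cdens_ratio k x : 0 < k -> intA (w + x) ->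
  cdens k (w + x) = cdens k w * expR (k * Phi a b (fun p q =>
     ln (sin (p + q)) - ln (sin p) - cot p * q) w x).
Proof.
move=> k0 hx; rewrite !cdens_exp// -expRD; congr expR.
rewrite -mulrDr PhiE_shift; congr (_ * _).
rewrite -[in RHS]addrA; congr (_ + _).
have -> : (fun p q => ln (sin (p + q)) - ln (sin p) - cot p * q) =
  (fun p q => ln (sin (p + q)) + (-1 * ln (sin p) + -1 * (cot p * q))) :> (R -> R -> R).
  by apply/funext => p; apply/funext => q; ring.
rewrite 2!PhiD !PhiZ w_crit mulr0 addr0 addrCA.
rewrite (_ : Phi a b (fun p _ => ln (sin p)) w x = Phi a b (fun p _ => ln (sin p)) w 0).
  by ring.
by [].
Qed.

Lemma cdens_w_gt0 k : 0 < k -> 0 < cdens k w.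
Proof. by move=> k0; rewrite cdens_exp// expR_gt0. Qed.

Lemma cdens_le k t : 0 < k ->
  cdens k t <= cdens k w * expR (- (2 * b * k * \sum_(i < N) (t 0 i - w 0 i) ^+ 2)).
Proof.
move=> k0; case: (pselect (intA t)) => [ht|nt]; last first.
  by rewrite cdens_eq0// mulr_ge0 ?cdens_ge0 ?expR_ge0.
have -> : t = w + (t - w) by rewrite addrC subrK.
set x := t - w; have hx : intA (w + x) by rewrite /x addrC subrK.
rewrite cdens_ratio// ler_wpM2l ?cdens_ge0// ler_expR.
have -> : \sum_(i < N) ((w + x) 0 i - w 0 i) ^+ 2 = \sum_(i < N) x 0 i ^+ 2.
  by apply: eq_bigr => i _; rewrite mxE addrAC subrr add0r.
rewrite [2 * b * k]mulrC -mulrA -mulrN ler_wpM2l ?(ltW k0)//.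
apply: (@le_trans _ _ (Phi a b (fun p q => - q ^+ 2 / 2) w x)).
  have E (p q : R) : 0 < p < pi -> 0 < p + q < pi ->
      ln (sin (p + q)) - ln (sin p) - cot p * q <= - q ^+ 2 / 2.
    move=> hp hq; have := lnsin_le hp hq.
    by have -> : p + q - p = q by ring.
  apply: le_Phi => //; rewrite ?(ltW b0)//.
  - move=> i j ij; apply: E; first exact: intA_add.
    by have := intA_add i j hx; rewrite !mxE; lra.
  - move=> i j ij; apply: E; first exact: intA_sub.
    by have := intA_sub hx ij; rewrite !mxE; lra.
  - move=> i; apply: E; first exact: intA_one.
    by have := intA_one i hx; rewrite !mxE; lra.
  - move=> i; apply: E; first exact: intA_two.
    by have := intA_two i hx; rewrite !mxE; lra.
(* The pair terms and those weighted by [a] are nonpositive and dropped; [b (2 x_i)^2 / 2] yields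
   the rate [2 b]. *)
rewrite /Phi -[leRHS]add0r lerD//.
  apply: sumr_le0 => i _; apply: sumr_le0 => j _.
  by have := sqr_ge0 (x 0 i + x 0 j); have := sqr_ge0 (x 0 i - x 0 j); lra.
rewrite mulr_sumr -sumrN; apply: ler_sum => i _.
have : 0 <= a * x 0 i ^+ 2 by rewrite mulr_ge0 ?sqr_ge0.
by rewrite exprMn; lra.
Qed.

Lemma near_intA (t_ : nat -> 'rV[R]_N) :
  (forall i, t_ n 0 i @[n --> \oo] --> w 0 i) -> \forall n \near \oo, intA (t_ n).
Proof.
move=> ht; have [h1 h2] := wA.
have n1 : \forall n \near \oo, forall i, 0 < t_ n 0 i < pi / 2.
  apply: filter_forall => i; have /andP[w0 w1] := h1 i.
  near=> n; apply/andP; split; near: n.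
    exact: (cvgr_gt (w 0 i)).
  exact: (cvgr_lt (w 0 i)).
have n2 : \forall n \near \oo, forall i j : 'I_N, (i < j)%N -> t_ n 0 j < t_ n 0 i.
  apply: filter_forall => i; apply: filter_forall => j.
  case: (boolP (i < j)%N) => [ij|_]; last exact: nearW.
  have c : t_ n 0 i - t_ n 0 j @[n --> \oo] --> w 0 i - w 0 j by apply: cvgB.
  have c0 : 0 < w 0 i - w 0 j by rewrite subr_gt0; exact: h2.
  near=> n => _; rewrite -subr_gt0; near: n.
  exact: (cvgr_gt _ c _ c0).
by apply: filterS2 n1 n2 => n; split.
Unshelve. all: by end_near. Qed.

Lemma cdens_cvg (k : nat -> R) x : (forall n, 0 < k n) -> k n @[n --> \oo] --> +oo ->
  cdens (k n) (w + (Num.sqrt (k n))^-1 *: x) / cdens (k n) w @[n --> \oo] -->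
  expR (- Phi a b (fun p q => q ^+ 2 / sin p ^+ 2) w x / 2).
Proof.
move=> k0 ky; set L := Phi _ _ _ _ _.
pose phi_ n (p q : R) := k n * (ln (sin (p + q / Num.sqrt (k n))) - ln (sin p)
  - cot p * (q / Num.sqrt (k n))).
have PhiS n : Phi a b (phi_ n) w x = k n * Phi a b (fun p q =>
     ln (sin (p + q)) - ln (sin p) - cot p * q) w ((Num.sqrt (k n))^-1 *: x).
  rewrite -PhiZ /Phi /phi_; congr (_ + _); apply: eq_bigr => i _.
    apply: eq_bigr => j _; rewrite !mxE.
    by rewrite ![(Num.sqrt (k n))^-1 * x 0 _]mulrC -mulrDl -mulrBl.
  by rewrite !mxE ![(Num.sqrt (k n))^-1 * x 0 _]mulrC !mulrA.
have c1 : Phi a b (phi_ n) w x @[n --> \oo] --> - L / 2.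
  have -> : - L / 2 = Phi a b (fun p q => - (q ^+ 2 / sin p ^+ 2) / 2) w x.
    transitivity (Phi a b (fun p q => (- 2^-1) * (q ^+ 2 / sin p ^+ 2)) w x).
      by rewrite PhiZ -/L; ring.
    by apply: eq_Phi => // p q _; ring.
  by apply: cvg_Phi => // p q hp; exact: lnsin_cvg.
have c2 : expR (Phi a b (phi_ n) w x) @[n --> \oo] --> expR (- L / 2).
  by apply: cvg_comp; [exact: c1 | exact: continuous_expR].
(* The exponential formula holds only inside the chamber, which the rescaled point enters
   eventually. *)
apply: cvg_trans c2; apply: near_eq_cvg.
have hd i : w 0 i + (Num.sqrt (k n))^-1 * x 0 i @[n --> \oo] --> w 0 i.
  rewrite -[X in _ --> X](addr0 (w 0 i)); apply: cvgD; first exact: cvg_cst.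
  rewrite -(mul0r (x 0 i)); apply: cvgM; last exact: cvg_cst.
  exact: cvg_invsqrt0.
have ht i : (w + (Num.sqrt (k n))^-1 *: x) 0 i @[n --> \oo] --> w 0 i.
  by under eq_fun do rewrite !mxE; exact: hd.
have := near_intA ht; apply: filterS => n hn.
rewrite cdens_ratio// mulrAC divff ?mul1r ?PhiS// gt_eqF//.
exact: cdens_w_gt0.
Qed.

End AtMax.
End Density.

(** * Laplace's method *)

Section Laplace.
Variables (R : realType) (N : nat) (a b : R).
Hypotheses (a0 : 0 <= a) (b0 : 0 < b).
Notation mu := (@lebesgue_measure R).
Implicit Types (v : nat -> R) (g : 'rV[R]_N -> R).

Definition rowN v : 'rV[R]_N := \row_(i < N) v i.

(** Used twice: with [d = 4 b k], centred at [w], in the original variables, and with [d = 4 b],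
    centred at 0, after rescaling. *)
Definition gauss_dom (d : R) (m : nat -> R) (i : nat) (x : R) : R :=
  expR (- (d * (x + m i) ^+ 2) / 2).

Lemma gauss_dominant d m : 0 < d -> dominant (gauss_dom d m).
Proof.
move=> d0; split=> [i x|i x|i]; first exact: expR_ge0.
  rewrite /gauss_dom -expR0 ler_expR mulNr oppr_le0 divr_ge0// mulr_ge0 ?sqr_ge0//.
  exact: ltW.
exact: (Rintegral_gauss 1 (m i) d0).1.
Qed.

Lemma prod_gauss_dom d m v : \prod_(i < N) gauss_dom d m i (v i) =
  expR (- (d / 2 * \sum_(i < N) (v i + m i) ^+ 2)).
Proof.
rewrite mulr_sumr -sumrN expR_sum; apply: eq_bigr => i _; congr expR; ring.
Qed.

Lemma seq_cts_comp_row g (c : R) (u : 'rV[R]_N) : continuous g ->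
  seq_cts (fun v => g (c *: (rowN v - u))).
Proof.
move=> cg v_ v hv.
pose s_ k i := c * (v_ k i - oapp (fun j => u 0 j) 0 (insub i)).
pose s i := c * (v i - oapp (fun j => u 0 j) 0 (insub i)).
have e t : c *: (rowN t - u) = \row_(i < N) (c * (t i - oapp (fun j => u 0 j) 0 (insub (i : nat)))).
  by apply/rowP => i; rewrite !mxE valK.
rewrite e; under eq_fun do rewrite e.
apply: (@cvg_comp _ _ _ (fun k => \row_(i < N) s_ k i) g _ (nbhs (\row_(i < N) s i))).
  apply: cvg_row => i; apply: cvgM; first exact: cvg_cst.
  by apply: cvgB; [exact: hv | exact: cvg_cst].
exact: cg.
Qed.

Lemma seq_ctsM (f1 f2 : (nat -> R) -> R) : seq_cts f1 -> seq_cts f2 ->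
  seq_cts (fun v => f1 v * f2 v).
Proof. by move=> c1 c2 v_ v hv; apply: cvgM; [exact: c1 | exact: c2]. Qed.

Variable w : 'rV[R]_N.
Hypothesis wA : intA w.
Hypothesis w_crit : forall x, Phi a b (fun p q => cot p * q) w x = 0.
Variable S : 'M[R]_N.
Hypothesis w_hess : forall x, Phi a b (fun p q => q ^+ 2 / sin p ^+ 2) w x = qform S x.
Hypotheses (Ssym : S^T = S) (Sge : forall x : 'rV[R]_N, 4 * b * \sum_(i < N) x 0 i ^+ 2 <= qform S x).

(** [w] extended by 0 to all indices, as the substitution shifts functions on [nat]; only the first
    [N] values matter. *)
Let W (i : nat) : R := oapp (fun j => w 0 j) 0 (insub i).

Let WE (i : 'I_N) : W i = w 0 i.
Proof. by rewrite /W valK. Qed.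

Let D (k : R) := cdens a b k w.

Let D_gt0 k : 0 < k -> 0 < D k.
Proof. exact: cdens_w_gt0. Qed.

Definition psi (k : R) v := cdens a b k (w + (Num.sqrt k)^-1 *: rowN v) / D k.

Lemma psi_ge0 k v : 0 < k -> 0 <= psi k v.
Proof. by move=> k0; rewrite divr_ge0 ?cdens_ge0// ltW// D_gt0. Qed.

Lemma psi_le k v : 0 < k -> psi k v <= \prod_(i < N) gauss_dom (4 * b) (fun=> 0) i (v i).
Proof.
move=> k0; rewrite ler_pdivrMr ?D_gt0// mulrC.
apply: (le_trans (cdens_le a0 b0 wA w_crit _ k0)).
rewrite ler_wpM2l ?cdens_ge0// prod_gauss_dom ler_expR lerN2.
rewrite le_eqVlt; apply/orP; left; apply/eqP; rewrite !mulr_sumr.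
apply: eq_bigr => i _; rewrite !mxE addr0 addrAC subrr add0r exprMn exprVn.
by rewrite sqr_sqrtr ?ltW//; field; rewrite gt_eqF.
Qed.

Lemma seq_cts_psi k : 0 < k -> seq_cts (psi k).
Proof.
move=> k0 v_ v hv; apply: cvgM; last exact: cvg_cst.
apply: cvg_cdens => // i; under eq_fun do rewrite !mxE; rewrite !mxE.
apply: cvgD; first exact: cvg_cst.
by apply: cvgM; [exact: cvg_cst | exact: hv].
Qed.

Lemma seq_cts_cdens k : 0 < k -> seq_cts (fun v => cdens a b k (rowN v)).
Proof.
move=> k0 v_ v hv; apply: cvg_cdens => // i.
by under eq_fun do rewrite mxE; rewrite mxE; exact: hv.
Qed.

Section Test.
Variables (g : 'rV[R]_N -> R) (M : R).
Hypotheses (cg : continuous g) (gM : forall x, `|g x| <= M).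

Let M0 : 0 <= M. Proof. exact: le_trans (normr_ge0 _) (gM 0). Qed.

Definition Ipsi k := iter_int_fun N (fun v => g (rowN v) * psi k v).

Let seq_cts_g : seq_cts (fun v => g (rowN v)).
Proof.
have := @seq_cts_comp_row g 1 0 cg; congr seq_cts; apply/funext => v.
by rewrite scale1r subr0.
Qed.

Let F k v := g (Num.sqrt k *: (rowN v - w)) * cdens a b k (rowN v).

Let F_cts k : 0 < k -> seq_cts (F k).
Proof.
move=> k0; apply: seq_ctsM; first exact: seq_cts_comp_row.
exact: seq_cts_cdens.
Qed.

Let F_dom k : 0 < k ->
  prod_dominated (gauss_dom (4 * b * k) (fun i => - W i)) N (M * D k) (F k).
Proof.
move=> k0 v; rewrite normrM -mulrA ler_pM//.
rewrite ger0_norm ?cdens_ge0// (le_trans (cdens_le a0 b0 wA w_crit _ k0))//.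
rewrite ler_wpM2l ?cdens_ge0// prod_gauss_dom ler_expR lerN2.
rewrite le_eqVlt; apply/orP; left; apply/eqP; rewrite !mulr_sumr.
by apply: eq_bigr => i _; rewrite WE !mxE; field.
Qed.

Let F_int k : 0 < k ->
  iter_int_fun N (F k) = (Num.sqrt k)^-1 ^+ N * (D k * Ipsi k).
Proof.
move=> k0; have sk : 0 < Num.sqrt k by rewrite sqrtr_gt0.
have d0 : 0 < 4 * b * k by rewrite !mulr_gt0.
have MD : 0 <= M * D k by rewrite mulr_ge0// ltW// D_gt0.
have sk' : 0 < (Num.sqrt k)^-1 by rewrite invr_gt0.
rewrite (@iter_int_affine _ _ N _ _ W _ sk' (gauss_dominant _ d0) MD (F_cts k0) (F_dom k0)).
  congr (_ * _).
  have e v : F k (fun i => W i + (Num.sqrt k)^-1 * v i) = D k * (g (rowN v) * psi k v).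
    have -> : F k (fun i => W i + (Num.sqrt k)^-1 * v i) =
       g (rowN v) * cdens a b k (w + (Num.sqrt k)^-1 *: rowN v).
      have rE : rowN (fun i => W i + (Num.sqrt k)^-1 * v i) = w + (Num.sqrt k)^-1 *: rowN v.
        by apply/rowP => i; rewrite !mxE WE.
      by rewrite /F rE addrAC subrr add0r scalerA divff ?gt_eqF// scale1r.
    by rewrite /psi; field; rewrite gt_eqF// D_gt0.
  rewrite (iter_int_eq N e).
  have d4 : 0 < 4 * b by rewrite mulr_gt0.
  apply: (iter_intZ _ (gauss_dominant (fun=> 0) d4) M0).
    by apply: seq_ctsM => //; exact: seq_cts_psi.
  by move=> v; rewrite normrM ler_pM// ger0_norm ?psi_ge0// psi_le.
move=> v v' vv; rewrite /F.
by have -> : rowN v = rowN v' by apply/rowP => i; rewrite !mxE vv.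
Qed.

Lemma seq_cts_gaussS : seq_cts (fun v => g (rowN v) * expR (- qform S (rowN v) / 2)).
Proof.
apply: seq_ctsM => // v_ v hv; apply: cvg_comp; last exact: continuous_expR.
apply: cvgM; last exact: cvg_cst.
apply: cvgN; rewrite -w_hess; under eq_fun do rewrite -w_hess.
have hr i : rowN (v_ n) 0 i @[n --> \oo] --> rowN v 0 i.
  by under eq_fun do rewrite mxE; rewrite mxE; exact: hv.
have hq (c : nat -> R) (l p : R) : c n @[n --> \oo] --> l ->
    c n ^+ 2 / p @[n --> \oo] --> l ^+ 2 / p.
  move=> hc; apply: cvgM; last exact: cvg_cst.
  by under eq_fun do rewrite expr2; rewrite expr2; exact: cvgM.
apply: cvgD; apply: cvg_bigsum => i _.
  by apply: cvg_bigsum => j _; apply: cvgD; apply: hq; [apply: cvgD | apply: cvgB].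
apply: cvgD; (apply: cvgM; first exact: cvg_cst); apply: hq => //.
by apply: cvgM => //; exact: cvg_cst.
Qed.

Lemma gaussS_dominated : prod_dominated (gauss_dom (4 * b) (fun=> 0)) N M
  (fun v => g (rowN v) * expR (- qform S (rowN v) / 2)).
Proof.
move=> v; rewrite normrM ler_pM// ger0_norm ?expR_ge0//.
rewrite prod_gauss_dom ler_expR mulNr lerN2.
have := Sge (rowN v).
have -> : \sum_(i < N) (rowN v) 0 i ^+ 2 = \sum_(i < N) (v i + 0) ^+ 2.
  by apply: eq_bigr => i _; rewrite mxE addr0.
lra.
Qed.

Lemma Ipsi_cvg (k : nat -> R) : (forall n, 0 < k n) -> k n @[n --> \oo] --> +oo ->
  Ipsi (k n) @[n --> \oo] -->
  iter_int_fun N (fun v => g (rowN v) * expR (- qform S (rowN v) / 2)).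
Proof.
move=> k0 ky; have d4 : 0 < 4 * b by rewrite mulr_gt0.
have [_ dct] := iter_int_dominated (gauss_dominant (fun=> 0) d4) N.
apply: (dct M) => //.
- by move=> n; apply: seq_ctsM => //; exact: seq_cts_psi.
- exact: seq_cts_gaussS.
- by move=> n v; rewrite normrM ler_pM// ger0_norm ?psi_ge0// psi_le.
- exact: gaussS_dominated.
- move=> v; apply: cvgM; first exact: cvg_cst.
  by rewrite -w_hess; exact: cdens_cvg.
Qed.

Lemma int_gauss_pdf : 
  int_Rn (fun x => g x * gauss_pdf (invmx S) x) =
  (2 * pi) `^ (- (N%:R / 2)) / Num.sqrt (\det (invmx S)) *
  iter_int_fun N (fun v => g (rowN v) * expR (- qform S (rowN v) / 2)).
Proof.
have d4 : 0 < 4 * b by rewrite mulr_gt0.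
rewrite -(iter_intZ _ (gauss_dominant (fun=> 0) d4) M0 seq_cts_gaussS gaussS_dominated).
by apply: iter_int_eq => v; rewrite /gauss_pdf invmxK /qform; ring.
Qed.

Lemma expect_int k : 0 < k -> expect_scaled a b k w g =
  (int_Rn (@dens_unnorm R N a b k))^-1 * ((Num.sqrt k)^-1 ^+ N * (D k * Ipsi k)).
Proof.
move=> k0; rewrite -F_int// /expect_scaled {1}/int_Rn; set Z := int_Rn _.
have d0 : 0 < 4 * b * k by rewrite !mulr_gt0.
have MD : 0 <= M * D k by rewrite mulr_ge0// ltW// D_gt0.
rewrite -(iter_intZ _ (gauss_dominant (fun i => - W i) d0) MD (F_cts k0) (F_dom k0)).
apply: iter_int_eq => v; rewrite /dens -/Z dens_unnormE// -/(rowN v) /F; ring.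
Qed.

(** The normalizing constant in the shape of [expect_int], so that the factor in front of [Ipsi]
    cancels in the expectation. *)
Lemma int_test k : 0 < k -> (forall x, g x = 1) ->
  int_Rn (@dens_unnorm R N a b k) = (Num.sqrt k)^-1 ^+ N * (D k * Ipsi k).
Proof.
move=> k0 g1; rewrite -F_int//; apply: iter_int_eq => v.
by rewrite /F g1 mul1r dens_unnormE.
Qed.

End Test.

Let S_pos : posdef S.
Proof.
move=> x x0; apply: lt_le_trans (Sge x).
rewrite mulr_gt0 ?mulr_gt0// lt_def sumr_ge0 ?andbT; last by move=> i _; exact: sqr_ge0.
apply: contra x0; rewrite psumr_eq0; last by move=> i _; exact: sqr_ge0.
move=> /allP h; apply/eqP/rowP => i; rewrite mxE; apply/eqP.
by have := h i (mem_index_enum i); rewrite sqrf_eq0.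
Qed.

Lemma S_unit : S \in unitmx.
Proof.
by rewrite unitmxE unitfE gt_eqF//; have [] := iter_int_gauss 1 Ssym S_pos.
Qed.

Lemma invS_sym : (invmx S)^T = invmx S.
Proof. by rewrite trmx_inv Ssym. Qed.

Lemma invS_pos : posdef (invmx S).
Proof.
move=> x x0; have u := S_unit.
have y0 : x *m invmx S != 0.
  by apply: contra_neq x0 => h; rewrite -(mulmxKV u x) h mul0mx.
have := S_pos y0; rewrite /qform mulmxKV// trmx_mul invS_sym mulmxA.
by [].
Qed.

Lemma laplace_cvg : cvg_dist_normal a b w (invmx S).
Proof.
move=> g cg [M gM]; apply/cvg_pinftyP => k ky.
(* [k] is positive only eventually, whereas the lemmas ask for it at every index. *)
pose k' n := Num.max 1 (k n).
have k'0 n : 0 < k' n by rewrite lt_max ltr01.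
have k'y : k' n @[n --> \oo] --> +oo.
  apply/cvgryPge => A; move/cvgryPge : ky => /(_ A); apply: filterS => n h.
  by rewrite le_max h orbT.
have one_c : continuous (fun _ : 'rV[R]_N => (1 : R)).
  exact: (@cst_continuous 'rV[R]_N R (1 : R)).
have one_M (x : 'rV[R]_N) : `|(fun=> 1 : R) x| <= 1 by rewrite normr1.
set J := iter_int_fun N (fun v => g (rowN v) * expR (- qform S (rowN v) / 2)).
have c1 := Ipsi_cvg cg gM k'0 k'y.
have c2 := Ipsi_cvg one_c one_M k'0 k'y.
have [det0 J1] := iter_int_gauss 1 Ssym S_pos.
set K := (2 * pi) `^ (- (N%:R / 2)) / Num.sqrt (\det (invmx S)) : R.
have p0 : 0 < 2 * pi :> R by rewrite mulr_gt0 ?pi_gt0.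
(* For the covariance [invmx S], the constant of [gauss_pdf] is the inverse of the limit of
   [Ipsi (fun=> 1)]. *)
have KJ : K = (Num.sqrt ((2 * pi) ^+ N / \det S))^-1.
  rewrite /K det_inv powRN powRrM powR12_sqrt ?powR_ge0// powR_mulrn ?(ltW p0)//.
  rewrite !sqrtrM ?exprn_ge0 ?(ltW p0)// !sqrtrV ?(ltW det0)// invrK invfM invrK.
  by [].
rewrite (int_gauss_pdf cg gM) -/K -/J KJ.
have c3 : expect_scaled a b (k' n) w g @[n --> \oo] -->
    (Num.sqrt ((2 * pi) ^+ N / \det S))^-1 * J.
  have J1' : iter_int_fun N (fun v => 1 * expR (- qform S (rowN v) / 2)) =
      Num.sqrt ((2 * pi) ^+ N / \det S) by rewrite J1 mul1r.
  have e n : expect_scaled a b (k' n) w g = (Ipsi (fun=> 1) (k' n))^-1 * Ipsi g (k' n).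
    rewrite (expect_int cg gM)// (int_test one_c one_M)//.
    have d1 : (Num.sqrt (k' n))^-1 ^+ N * D (k' n) != 0.
      by rewrite mulf_neq0 ?expf_neq0 ?invr_eq0 ?gt_eqF ?sqrtr_gt0// D_gt0.
    rewrite (mulrA _ (D _) (Ipsi (fun=> 1) _)) (mulrA _ (D _) (Ipsi g _)).
    by rewrite invfM mulrACA mulVf// mul1r.
  under eq_fun do rewrite e.
  apply: cvgM => //; apply: cvgV; last by rewrite -J1'.
  by rewrite gt_eqF// sqrtr_gt0 divr_gt0// exprn_gt0.
apply: cvg_trans c3; apply: near_eq_cvg.
move/cvgryPge : ky => /(_ 1); apply: filterS => n h.
by rewrite /k' (max_idPr h).
Qed.

End Laplace.

Unset Implicit Arguments.

Theorem theorem2p5 (R : realType) (N : nat) (a b : R) (z : 'I_N -> R) :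
  0 <= a -> 0 < b ->
  {homo z : i j / (i < j)%N >-> i < j} ->
  (forall i, root (jacobi N (a + b - 1) (b - 1)) (z i)) ->
  let al := a + b - 1 in
  let be := b - 1 in
  let w : 'rV[R]_N := \row_(i < N) (acos (z i) / 2) in
  let S := Stilde a b z in
  (exists Sigma : 'M[R]_N,
      Sigma^T = Sigma /\
      (forall x : 'rV[R]_N, x != 0 -> 0 < (x *m Sigma *m x^T) 0 0) /\
      Sigma \in unitmx /\ invmx Sigma = S /\
      cvg_dist_normal a b w Sigma) /\
  char_poly S = \prod_(k < N) ('X - (lambda N al be k.+1)%:P) /\
  {in [pred k : nat | (0 < k <= N)%N] &, injective (lambda N al be)} /\
  (forall k : 'I_N, 0 < lambda N al be k.+1) /\
  (exists q : 'I_N -> {poly R},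
      (forall k : 'I_N, size (q k) = k.+1) /\
      (forall k l : 'I_N,
         \sum_(i < N) (1 - z i ^+ 2) * (q k).[z i] * (q l).[z i]
           = (k == l)%:R) /\
      (forall k : 'I_N,
         let v : 'cV[R]_N := \col_(i < N) ((q k).[z i] * Num.sqrt (1 - z i ^+ 2)) in
         v != 0 /\ S *m v = lambda N al be k.+1 *: v)).
Proof.
move=> a0 b0 zm zr al be w S.
have hal : -1 < al by rewrite /al; lra.
have hbe : -1 < be by rewrite /be; lra.
have z_itv i : -1 < z i < 1 by exact: root_jacobi_itv hal hbe (zr i).
have zi : injective z.
  by move=> i j e; apply/val_inj; case: (ltngtP i j) => // /zm; rewrite e ltxx.
have z_eq j : 2 * \sum_(l < N | l != j) (z j - z l)^-1 =
    (a + b) / (1 - z j) - b / (1 + z j).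
  by rewrite (stieltjes j hal hbe zi zr) /al /be !subrK.
have wA : intA w by exact: intA_w.
have grad x : Phi a b (fun p q => cot p * q) w x = 0 by exact: Phi_grad.
have hess x : Phi a b (fun p q => q ^+ 2 / sin p ^+ 2) w x = qform S x.
  exact: Phi_hess.
have Ssym : S^T = S by exact: Stilde_sym.
have Sge (x : 'rV[R]_N) : 4 * b * \sum_(i < N) x 0 i ^+ 2 <= qform S x.
  exact: qform_ge.
split; last split; last split; last split.
- exists (invmx S); split; first exact: invS_sym.
  split; first by move=> x x0; exact: (invS_pos b0 Ssym Sge x0).
  split; first by rewrite unitmx_inv; exact: (S_unit b0 Ssym Sge).
  split; first exact: invmxK.
  exact: (laplace_cvg a0 b0 wA grad hess Ssym Sge).
- exact: char_poly_Stilde.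
- exact: lam_inj.
- by move=> k; exact: lam_gt0.
- exact: eigen_family.
Qed.
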